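(* Let $\widehat{\mathbf O}_r$ be the output of WildCat with rank parameter $r$ and a single bin ($B=1$). Fix $a\geq \frac{1}{2}$ and define the entry and dimension growth parameters \[ \gamma \defeq \frac{\beta R_{\mathbf Q} R_{\mathbf K}}{\log(n)} \qquad\text{and}\qquad \delta \defeq \frac{d}{\log(n)}, \] along with the Taylor growth parameter \[ \sigma \defeq \frac{a + \gamma}{W_0\!\left(\frac{1}{2\rho_0 \gamma} + \frac{1}{\rho_0}\right)}. \] Then $\mathbb E\,\|\mathbf O - \widehat{\mathbf O}_r\|_{\max} \leq 3\|\mathbf V\|_{\max}\, n^{-a}$ provided \[ r \geq 1 + \frac{1}{\sqrt{\pi}}\, n^{(\sigma + \delta)\mathrm{Ent}\left(\frac{\sigma}{\sigma + \delta}\right)}\log\!\left(n^{2a + \sigma + 3\gamma}\right). \] For $B > 1$ bins, the same result holds with the effective sequence length and rank $(n_{\mathrm{eff}},r_{\mathrm{eff}}) = (\lfloor n/B\rfloor, \lceil r/B\rceil)$ in place of $(n,r)$.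
   Context: Queries $\mathbf Q=(\mathbf q_i)_{i\in[m]}\in\mathbb R^{m\times d}$, keys $\mathbf K=(\mathbf k_l)_{l\in[n]}\in\mathbb R^{n\times d}$, values $\mathbf V=(\mathbf v_l)_{l\in[n]}\in\mathbb R^{n\times d}$, scale $\beta>0$. The attention matrix is $\mathbf A_{il}=\exp(\beta\langle \mathbf q_i,\mathbf k_l\rangle)$, $\mathbf D=\mathrm{diag}(\mathbf A\mathbf 1_n)$, and the exact softmax output is $\mathbf O=\mathbf D^{-1}\mathbf A\mathbf V$. Norms: $\|\mathbf M\|_{\max}=\max_{i,j}|\mathbf M_{ij}|$; $R_{\mathbf Q}=\max_i\|\mathbf q_i\|_2$; $R_{\mathbf K}=\max_l\|\mathbf k_l-\bar{\mathbf k}\|_2$ with $\bar{\mathbf k}=\frac1n\sum_l\mathbf k_l$ (keys are recentred, which leaves $\mathbf O$ unchanged). $W_0$ is the principal branch of the Lambert W function (solution $w>-1$ of $we^w=z$), $\rho_0\defeq\sqrt{1+e^{W_0(2/e^2)+2}}\approx 3.19$, and $\mathrm{Ent}(p)\defeq -p\log p-(1-p)\log(1-p)$. WildCat (with $B=1$) does the following: set $(\mathbf v_{\min})_j=\min_l \mathbf v_{lj}$, $(\mathbf v_{\max})_j=\max_l\mathbf v_{lj}$; recentre keys by $\bar{\mathbf k}$; choose temperature $\tau=\sqrt{\frac{R_{\mathbf K}}{R_{\mathbf Q}}\frac{b_0}{2W_0(b_0/(2\rho_0))}}$ with $b_0=\frac{\log n}{\beta R_{\mathbf Q}R_{\mathbf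 K}}+2$; run randomly pivoted Nyström on the recentred keys with kernel $h_\tau(\mathbf x,\mathbf y)=\exp(\beta\langle\mathbf x,\mathbf y\rangle/\tau^2)$ and rank $r$ (sequentially sample $r$ pivot indices $\mathcal S$, each with probability proportional to the current diagonal of the residual kernel $h_\tau - h_\tau(\cdot,\mathbf K_{\mathcal S})h_\tau(\mathbf K_{\mathcal S},\mathbf K_{\mathcal S})^{-1}h_\tau(\mathbf K_{\mathcal S},\cdot)$), obtaining Nyström weights $\mathbf W=h_\tau(\mathbf K_{\mathcal S},\mathbf K_{\mathcal S})^{-1}h_\tau(\mathbf K_{\mathcal S},\mathbf K)$; form $\mathbf V_{\mathcal S}=\mathbf W\mathbf V$, $\mathbf w=\mathbf W\mathbf 1_n$; and output $\widehat{\mathbf O}=\mathrm{clip}(\mathrm{diag}(\widehat{\mathbf A}\mathbf w)^{-1}\widehat{\mathbf A}\mathbf V_{\mathcal S},\mathbf v_{\min},\mathbf v_{\max})$ with $\widehat{\mathbf A}=\exp(\beta\mathbf Q\mathbf K_{\mathcal S}^\top)$ (original keys of the coreset). With $B>1$, the keys are evenly split into $B$ bins and the compression with rank $r/B$ is applied to each bin separately, results concatenated. *)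

(* Defs.v *)
From HB Require Import structures.
From mathcomp Require Import all_boot all_order all_algebra.
From mathcomp Require Import all_classical all_reals all_analysis.
Set Implicit Arguments. Unset Strict Implicit. Unset Printing Implicit Defensive.
Import Order.TTheory GRing.Theory Num.Theory.
Local Open Scope ring_scope.
Local Open Scope classical_set_scope.

Section WildCat.
Context {R : realType}.

Definition lambertW0 (z : R) : R :=
  xget 0 [set w : R | -1 < w /\ w * expR w = z].

Definition rho0 : R :=
  Num.sqrt (1 + expR (lambertW0 (2 / expR 2) + 2)).

Definition Ent (p : R) : R := - p * ln p - (1 - p) * ln (1 - p).

Definition clip (x lo hi : R) : R := Num.min (Num.max x lo) hi.

Definition maxnorm (m n : nat) (M : 'M[R]_(m, n)) : R :=
  \big[Num.max/0]_(i < m) \big[Num.max/0]_(j < n) `|M i j|.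

Definition dotr (d : nat) (x y : 'rV[R]_d) : R := \sum_(j < d) x 0 j * y 0 j.
Definition norm2 (d : nat) (x : 'rV[R]_d) : R := Num.sqrt (dotr x x).

Context {m n d : nat}.

Definition RQ (Q : 'M[R]_(m, d)) : R := \big[Num.max/0]_(i < m) norm2 (row i Q).
Definition kbar (K : 'M[R]_(n, d)) : 'rV[R]_d := n%:R^-1 *: \sum_(l < n) row l K.
Definition RK (K : 'M[R]_(n, d)) : R :=
  \big[Num.max/0]_(l < n) norm2 (row l K - kbar K).

Definition attnA (beta : R) (Q : 'M[R]_(m, d)) (K : 'M[R]_(n, d)) i l : R :=
  expR (beta * dotr (row i Q) (row l K)).
Definition exactO (beta : R) (Q : 'M[R]_(m, d)) (K V : 'M[R]_(n, d)) : 'M[R]_(m, d) :=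
  \matrix_(i, j) ((\sum_(l < n) attnA beta Q K i l * V l j) /
                  (\sum_(l < n) attnA beta Q K i l)).

Definition piv (S : seq 'I_n) (t : 'I_(size S)) : 'I_n := tnth (in_tuple S) t.
Definition KSS (kern : 'I_n -> 'I_n -> R) (S : seq 'I_n) : 'M[R]_(size S) :=
  \matrix_(s, t) kern (piv s) (piv t).
Definition resdiag (kern : 'I_n -> 'I_n -> R) (S : seq 'I_n) (l : 'I_n) : R :=
  kern l l - ((\row_(t < size S) kern l (piv t)) *m invmx (KSS kern S)
               *m (\col_(t < size S) kern (piv t) l)) 0 0.
Definition nysW (kern : 'I_n -> 'I_n -> R) (S : seq 'I_n) : 'M[R]_(size S, n) :=
  invmx (KSS kern S) *m \matrix_(t, l) kern (piv t) l.

(** Expectation over randomly pivoted Nystrom (RPCholesky) pivot selection on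
    the index set [bin], with at most [k] further pivots starting from the
    current pivots [S], of the quantity [f] of the final pivot sequence.
    Each new pivot l in [bin] is drawn with probability proportional to the
    current residual diagonal; if the residual vanishes on [bin] the
    procedure stops early (approximation already exact). *)
Fixpoint rpExpect (kern : 'I_n -> 'I_n -> R) (bin : pred 'I_n) (k : nat)
    (S : seq 'I_n) (f : seq 'I_n -> R) {struct k} : R :=
  match k with
  | 0 => f S
  | k'.+1 =>
    let tot := \sum_(l < n | bin l) resdiag kern S l in
    if tot == 0 then f S
    else \sum_(l < n | bin l)
           (resdiag kern S l / tot) * rpExpect kern bin k' (rcons S l) f
  end.

(** Independent runs on successive bins; [acc] collects (bin, pivots). *)
Fixpoint binsExpect (kern : 'I_n -> 'I_n -> R) (k : nat) (bs : seq (pred 'I_n))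
    (acc : seq (pred 'I_n * seq 'I_n)) (f : seq (pred 'I_n * seq 'I_n) -> R)
    {struct bs} : R :=
  match bs with
  | [::] => f acc
  | b :: bs' => rpExpect kern b k [::]
                  (fun S => binsExpect kern k bs' (rcons acc (b, S)) f)
  end.

Definition bins (B : nat) : seq (pred 'I_n) :=
  [seq (fun l : 'I_n => (b * n %/ B <= l < b.+1 * n %/ B)%N) | b <- iota 0 B].

Definition wc_tau (beta : R) (Q : 'M[R]_(m, d)) (K : 'M[R]_(n, d)) (neff : nat) : R :=
  let b0 := ln (neff%:R) / (beta * RQ Q * RK K) + 2 in
  Num.sqrt (RK K / RQ Q * (b0 / (2 * lambertW0 (b0 / (2 * rho0))))).

Definition wc_kern (beta tau : R) (K : 'M[R]_(n, d)) (l l' : 'I_n) : R :=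
  expR (beta * dotr (row l K - kbar K) (row l' K - kbar K) / tau ^+ 2).

Definition wc_output (beta tau : R) (Q : 'M[R]_(m, d)) (K V : 'M[R]_(n, d))
    (acc : seq (pred 'I_n * seq 'I_n)) : 'M[R]_(m, d) :=
  let kern := wc_kern beta tau K in
  \matrix_(i, j)
    clip ((\sum_(p <- acc) \sum_(t < size p.2)
             attnA beta Q K i (tnth (in_tuple p.2) t) *
             (\sum_(l < n | p.1 l) nysW kern p.2 t l * V l j)) /
          (\sum_(p <- acc) \sum_(t < size p.2)
             attnA beta Q K i (tnth (in_tuple p.2) t) *
             (\sum_(l < n | p.1 l) nysW kern p.2 t l)))
         (\big[Num.min/head 0 [seq V l j | l <- enum 'I_n]]_(l < n) V l j)
         (\big[Num.max/head 0 [seq V l j | l <- enum 'I_n]]_(l < n) V l j).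

End WildCat.

(* Main.v *)
Require Import Defs.
From HB Require Import structures.
From mathcomp Require Import all_boot all_order all_algebra.
From mathcomp Require Import all_classical all_reals all_analysis.
From mathcomp Require Import ring lra.
Import Order.TTheory GRing.Theory Num.Theory.
Import numFieldNormedType.Exports.
Local Open Scope ring_scope.

(** Put g = beta RQ RK, L = ln neff and let w be the Lambert value in the
    definition of sigma.  After recentring, the attention entry (i, l) is the
    value at (tau^2 q_i, k_l) of the kernel exp (beta <x, y> / tau^2), and the
    weights produced by the pivots S replace it by this value minus the
    residual kernel R_S.  Recentring also makes every attention row sum at
    least n (Jensen), so the clipped ratio is off by at most
    (2 |V| / n) * sum_l |R_S (q_i, l)|.  Positivity of R_S bounds each
    |R_S (q_i, l)| linearly in the residual diagonal, so it suffices to bound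
    the expected residual trace on one bin.

    Let P be the orthogonal projection onto the monomials of degree at most
    s = floor (sigma L), of rank at most q = C(s + d, s), and split the
    residual trace as tr (P R) + tr ((1 - P) R).  The second part never
    increases and starts below a Taylor tail b of exp.  By Cauchy-Schwarz, one
    random pivot decreases the first part in expectation from [a] to at most
    a - a^2 / (q (a + b)), so ln a - b / a drops by 1 / q at every step.  The
    choice of tau makes b / n_bin at most half of exp (-2 a L - beta tau^2 RQ^2),
    and the rank condition drives the first part to the same order, because
    sqrt pi C(s + d, s) is at most the entropy exponential. *)

(** * Positive semidefinite kernels *)

Definition psd {R : realFieldType} {X : finType} (k : X -> X -> R) : Prop :=
  (forall x y, k x y = k y x) /\
  forall v : X -> R, 0 <= \sum_x \sum_y v x * v y * k x y.

Section Psd.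
Context {R : realFieldType} {X : finType}.
Implicit Types (k : X -> X -> R) (v : X -> R).

Lemma sum_delta (F : X -> R) l : \sum_x (x == l)%:R * F x = F l.
Proof.
rewrite (bigD1 l) //= eqxx mul1r big1 ?addr0// => x /negbTE ->.
by rewrite mul0r.
Qed.

Lemma quad_delta k l :
  \sum_x \sum_y (x == l)%:R * (y == l)%:R * k x y = k l l.
Proof.
under eq_bigr => x _ do under eq_bigr => y _ do rewrite -mulrA.
under eq_bigr => x _ do rewrite -mulr_sumr sum_delta.
by rewrite sum_delta.
Qed.

Lemma discriminant_le (q c k : R) : 0 <= k ->
  (forall t, 0 <= q + 2 * t * c + t ^+ 2 * k) -> c ^+ 2 <= k * q.
Proof.
rewrite le_eqVlt => /predU1P[<- H|k0 H].
  have [->|c0] := eqVneq c 0; first by rewrite expr0n mul0r.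
  (* With [k = 0] the bound is affine in [t], and at this [t] it equals -1. *)
  have := H (- (q + 1) / (2 * c)).
  suff -> : q + 2 * (- (q + 1) / (2 * c)) * c + (- (q + 1) / (2 * c)) ^+ 2 * 0 = -1.
    by rewrite oppr_ge0 ler10.
  by field.
have := H (- c / k).
have -> : q + 2 * (- c / k) * c + (- c / k) ^+ 2 * k = (k * q - c ^+ 2) / k.
  by field; rewrite gt_eqF.
by rewrite pmulr_lge0 ?invr_gt0// subr_ge0.
Qed.

Lemma psd_diag_ge0 k l : psd k -> 0 <= k l l.
Proof. by move=> [_ /(_ (fun x => (x == l)%:R))]; rewrite quad_delta. Qed.

(** Cauchy-Schwarz between [v] and the unit mass at [l]: the form evaluated at [v] plus [t] times
    that mass is a nonnegative quadratic in [t]. *)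
Lemma psd_cauchy k v l : psd k ->
  (\sum_x v x * k x l) ^+ 2 <= k l l * \sum_x \sum_y v x * v y * k x y.
Proof.
move=> pk; have [sk Hk] := pk; apply: discriminant_le => [|t].
  exact: psd_diag_ge0.
suff -> : \sum_x \sum_y v x * v y * k x y + 2 * t * (\sum_x v x * k x l) +
    t ^+ 2 * k l l = \sum_x \sum_y (v x + t * (x == l)%:R) * (v y + t * (y == l)%:R) * k x y.
  exact: Hk.
transitivity (\sum_x (\sum_y v x * v y * k x y + t * (v x * k x l) +
   (x == l)%:R * (t * (\sum_y v y * k l y) + t ^+ 2 * k l l))).
  rewrite !big_split /= sum_delta -mulr_sumr.
  have -> : \sum_y v y * k l y = \sum_x v x * k x l.
    by apply: eq_bigr => y _; rewrite sk.
  ring.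
apply: eq_bigr => x _.
have e : \sum_y (v x + t * (x == l)%:R) * (v y + t * (y == l)%:R) * k x y =
  \sum_y (v x * v y * k x y + (x == l)%:R * (t * (v y * k x y)) +
    (y == l)%:R * ((v x + t * (x == l)%:R) * t * k x y)).
  by apply: eq_bigr => y _; ring.
rewrite e !big_split /= sum_delta -2!mulr_sumr.
have [->|_] := eqVneq x l; rewrite /=; ring.
Qed.

Lemma psd_cauchy2 k x l : psd k -> k x l ^+ 2 <= k l l * k x x.
Proof.
move=> pk; have := psd_cauchy k (fun y => (y == x)%:R) l pk.
by rewrite quad_delta sum_delta.
Qed.

Lemma psd_diag_eq0 k x l : psd k -> k l l = 0 -> k x l = 0.
Proof.
move=> pk k0; have := psd_cauchy2 k x l pk.
by rewrite k0 mul0r => h; apply/eqP; rewrite -sqrf_eq0 eq_le h sqr_ge0.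
Qed.

(** Weighted AM-GM applied to [psd_cauchy2]. The bound is linear in [k l l], so it can be averaged
    over random pivots; [th] stays free to balance the two terms. *)
Lemma psd_amgm k x l (th : R) : 0 < th -> psd k ->
  `|k x l| <= (th * k x x + k l l / th) / 2.
Proof.
move=> th0 pk; have /= := psd_cauchy2 k x l pk.
have := psd_diag_ge0 k x pk; have := psd_diag_ge0 k l pk.
set p := k x x; set q := k l l; set c := k x l => q0 p0 h.
have m0 : 0 <= (th * p + q / th) / 2.
  apply: divr_ge0 => //.
  by apply: addr_ge0; [apply: mulr_ge0|apply: divr_ge0] => //; exact: ltW.
rewrite -ler_sqr ?nnegrE// real_normK ?num_real// (le_trans h)//.
rewrite -subr_ge0.
have -> : ((th * p + q / th) / 2) ^+ 2 - q * p = ((th * p - q / th) / 2) ^+ 2.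
  by field; rewrite gt_eqF.
exact: sqr_ge0.
Qed.

(** The Schur complement at [l], one step of pivoted Cholesky. If [k l l = 0] the quotient is 0 and
    the kernel is left unchanged. *)
Definition reduce k (l x y : X) : R := k x y - k x l * k l y / k l l.

(** The quadratic form drops by [(\sum_x v x * k x l) ^+ 2 / k l l], which [psd_cauchy] keeps below
    the form itself. *)
Lemma psd_reduce k l : psd k -> psd (reduce k l).
Proof.
move=> pk; have [sk Hk] := pk; split=> [x y|v].
  by rewrite /reduce (sk x y) (sk x l) (sk l y) (mulrC (k l x)).
have -> : \sum_x \sum_y v x * v y * reduce k l x y =
   \sum_x \sum_y v x * v y * k x y - (\sum_x v x * k x l) ^+ 2 / k l l.
  rewrite expr2 mulr_suml mulr_suml -sumrB; apply: eq_bigr => x _.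
  rewrite mulr_sumr mulr_suml -sumrB; apply: eq_bigr => y _.
  by rewrite /reduce (sk l y); ring.
have [k0|k0] := eqVneq (k l l) 0.
  by rewrite k0 invr0 mulr0 subr0.
rewrite subr_ge0 ler_pdivrMr 1?mulrC ?psd_cauchy//.
by rewrite lt0r k0 psd_diag_ge0.
Qed.

Lemma reduce_pivot k l y : k l l != 0 -> reduce k l l y = 0.
Proof. by move=> k0; rewrite /reduce mulrAC divff// mul1r subrr. Qed.

Lemma reduce_diag_le k l x : psd k -> reduce k l x x <= k x x.
Proof.
move=> pk; have [sk _] := pk; rewrite /reduce gerBl (sk l x).
by rewrite divr_ge0 ?psd_diag_ge0// -expr2 sqr_ge0.
Qed.

End Psd.

(** The test vector [v * w] is pushed forward by summing over the fibres of [f]. Later [w] is the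
    indicator of a bin. *)
Lemma psd_pullback {R : realFieldType} {X Y : finType} (k : X -> X -> R)
    (f : Y -> X) (w : Y -> R) :
  psd k -> psd (fun y y' => w y * w y' * k (f y) (f y')).
Proof.
move=> [sk Hk]; split=> [x y|v]; first by rewrite sk (mulrC (w x)).
have := Hk (fun x => \sum_(y | f y == x) v y * w y); congr (0 <= _).
rewrite [RHS](partition_big f xpredT)//=; apply: eq_bigr => x _.
under [RHS]eq_bigr => y _ do rewrite (partition_big f xpredT)//=.
rewrite exchange_big /=; apply: eq_bigr => x' _.
rewrite !mulr_suml; apply: eq_bigr => y /eqP fy.
rewrite mulr_sumr mulr_suml; apply: eq_bigr => z /eqP fz.
by rewrite fy fz; ring.
Qed.

(** * Orthogonal projections *)

Section Projection.
Context {R : realFieldType}.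

Lemma mxtrace_gram n p (A : 'M[R]_(n, p)) : \tr (A^T *m A) = \sum_j \sum_i A i j ^+ 2.
Proof.
apply: eq_bigr => j _; rewrite mxE; apply: eq_bigr => i _.
by rewrite mxE expr2.
Qed.

Lemma mxtrace_gram_ge0 n p (A : 'M[R]_(n, p)) : 0 <= \tr (A^T *m A).
Proof.
by rewrite mxtrace_gram sumr_ge0// => j _; rewrite sumr_ge0// => i _; rewrite sqr_ge0.
Qed.

Lemma mxtrace_gram_eq0 n p (A : 'M[R]_(n, p)) : \tr (A^T *m A) = 0 -> A = 0.
Proof.
rewrite mxtrace_gram => /eqP; rewrite psumr_eq0; last first.
  by move=> j _; rewrite sumr_ge0// => i _; rewrite sqr_ge0.
move=> /allP H; apply/matrixP => i j; rewrite mxE.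
have := H j (mem_index_enum _); rewrite psumr_eq0/=; last by move=> ? _; rewrite sqr_ge0.
by move=> /allP/(_ i (mem_index_enum _)); rewrite /= sqrf_eq0 => /eqP.
Qed.

Lemma mxtrace_cauchy n p (A B : 'M[R]_(n, p)) :
  \tr (A^T *m B) ^+ 2 <= \tr (A^T *m A) * \tr (B^T *m B).
Proof.
rewrite mulrC; apply: discriminant_le => [|t]; first exact: mxtrace_gram_ge0.
have := mxtrace_gram_ge0 _ _ (A + t *: B); congr (0 <= _).
have -> : (A + t *: B)^T = A^T + t *: B^T by rewrite linearD/= linearZ.
rewrite mulmxDl !mulmxDr -!scalemxAl -!scalemxAr !linearD/= !linearZ/=.
have -> : \tr (B^T *m A) = \tr (A^T *m B).
  by rewrite -mxtrace_tr trmx_mul trmxK.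
ring.
Qed.

Definition orthoproj n (P : 'M[R]_n) := P^T = P /\ P *m P = P.

Lemma orthoproj_compl n (P : 'M[R]_n) : orthoproj n P -> orthoproj n (1%:M - P).
Proof.
move=> [tP PP]; split; first by rewrite linearB/= trmx1 tP.
by rewrite mulmxBl !mulmxBr PP mul1mx mulmx1 mul1mx subrr subr0.
Qed.

(** Gram-Schmidt without square roots: each [g] adds the rank-one projection onto its component [u]
    orthogonal to the range so far, which raises the trace by 1, or adds nothing when [u = 0]. *)
Lemma orthoproj_span n (gs : seq 'cV[R]_n) :
  exists P, [/\ orthoproj n P, \tr P <= (size gs)%:R &
             forall g, g \in gs -> P *m g = g].
Proof.
elim: gs => [|g gs [P [[tP PP] trP Pg]]].
  exists 0; split => //; first by split; rewrite ?trmx0 ?mulmx0.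
  by rewrite mxtrace0.
pose u := g - P *m g.
have Pu : P *m u = 0 by rewrite mulmxBr mulmxA PP subrr.
have uP : u^T *m P = 0 by rewrite -{1}tP -trmx_mul Pu trmx0.
have [u0|u0] := eqVneq u 0.
  exists P; split => //; first by rewrite (le_trans trP)// ler_nat/=.
  move=> h; rewrite inE => /predU1P[->|/Pg//].
  by apply/esym/eqP; rewrite -subr_eq0; apply/eqP.
pose c := \tr (u^T *m u).
have c0 : c != 0 by apply: contra u0 => /eqP/mxtrace_gram_eq0 ->.
have uu : u^T *m u = c%:M by rewrite [LHS]mx11_scalar /c /mxtrace big_ord1.
pose U := c^-1 *: (u *m u^T).
have PU : P *m U = 0 by rewrite /U -scalemxAr mulmxA Pu mul0mx scaler0.
have UP : U *m P = 0 by rewrite /U -scalemxAl -mulmxA uP mulmx0 scaler0.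
have UU : U *m U = U.
  rewrite /U -scalemxAl -scalemxAr -!mulmxA (mulmxA u^T) uu.
  by rewrite mul_scalar_mx -scalemxAr !scalerA mulVf// mulr1.
exists (P + U); split.
- split.
    by rewrite linearD/= tP /U linearZ/= trmx_mul trmxK.
  by rewrite mulmxDl !mulmxDr PP PU UP UU addr0 add0r.
- rewrite linearD/= /U linearZ/= mxtrace_mulC -/c mulVf//.
  by rewrite -natr1 lerD2r.
- move=> h; rewrite inE => /predU1P[->|hg].
    have ge : g = u + P *m g by rewrite subrK.
    have ug : u^T *m g = c%:M by rewrite {1}ge mulmxDr uu mulmxA uP mul0mx addr0.
    rewrite mulmxDl /U -scalemxAl -mulmxA ug scalar_mxC mul_scalar_mx scalerA mulVf//.
    by rewrite scale1r addrC -ge.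
  have uh : u^T *m h = 0 by rewrite -(Pg _ hg) mulmxA uP mul0mx.
  by rewrite mulmxDl Pg// /U -scalemxAl -mulmxA uh mulmx0 scaler0 addr0.
Qed.

Lemma psd_mx_sym {n} {M : 'M[R]_n} : psd (fun i j => M i j) -> M^T = M.
Proof. by move=> [sM _]; apply/matrixP => i j; rewrite mxE sM. Qed.

(** The trace equals that of [P *m M *m P], a sum of values of the form [M] at the rows of [P]. *)
Lemma proj_trace_ge0 n (P M : 'M[R]_n) : orthoproj n P -> psd (fun i j => M i j) ->
  0 <= \tr (P *m M).
Proof.
move=> [tP PP] [_ HM]; rewrite -PP -mulmxA mxtrace_mulC.
apply: sumr_ge0 => i _.
have := HM (fun j => P i j); congr (0 <= _).
rewrite mxE exchange_big /=; apply: eq_bigr => j _.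
rewrite mxE mulr_suml; apply: eq_bigr => k _.
by rewrite -{2}tP mxE; ring.
Qed.

Lemma proj_sandwich n (P M : 'M[R]_n) : orthoproj n P -> M^T = M ->
  M *m P *m M = (P *m M)^T *m (P *m M).
Proof.
move=> [tP PP] tM.
by rewrite trmx_mul tP tM mulmxA -(mulmxA M P P) PP.
Qed.

(** Frobenius Cauchy-Schwarz between [P] and [P *m M]. *)
Lemma proj_trace_cauchy n (P M : 'M[R]_n) : orthoproj n P -> M^T = M ->
  \tr (P *m M) ^+ 2 <= \tr P * \tr (M *m P *m M).
Proof.
move=> hP tM; have [tP PP] := hP.
rewrite (proj_sandwich _ _ _ hP tM).
have := mxtrace_cauchy _ _ P (P *m M).
by rewrite tP mulmxA PP.
Qed.

Definition mxreduce n (M : 'M[R]_n) l := \matrix_(i, j) reduce (fun i j => M i j) l i j.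

(** A pivot subtracts a rank-one matrix. Drawing [l] with probability proportional to [M l l]
    cancels the denominator, so the mean decrease is [\tr (M *m P *m M)] over the trace of [M]. *)
Lemma proj_trace_reduce n (P M : 'M[R]_n) l :
  \tr (P *m mxreduce n M l) = \tr (P *m M) - (M *m P *m M) l l / M l l.
Proof.
have -> : mxreduce n M l = M - (M l l)^-1 *: (col l M *m row l M).
  by apply/matrixP => i j; rewrite !mxE big_ord1 !mxE mulrC.
rewrite mulmxBr linearB/= -scalemxAr linearZ/= mulmxA.
rewrite (mxtrace_mulC _ (row l M)) [\tr (row _ _ *m _)]big_ord1.
congr (_ - _); rewrite mulrC; congr (_ / _).
rewrite -[in RHS]mulmxA [LHS]mxE [RHS]mxE; apply: eq_bigr => k _.
by rewrite !mxE; congr (_ * _); apply: eq_bigr => j _; rewrite !mxE.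
Qed.

Lemma proj_sandwich_diag_ge0 n (P M : 'M[R]_n) l : orthoproj n P -> M^T = M ->
  0 <= (M *m P *m M) l l.
Proof.
move=> hP tM; rewrite (proj_sandwich _ _ _ hP tM) mxE sumr_ge0// => i _.
by rewrite [_^T _ _]mxE -expr2 sqr_ge0.
Qed.

(** Extends that cancellation to pivots of probability zero. *)
Lemma proj_sandwich_diag_eq0 n (P M : 'M[R]_n) l : psd (fun i j => M i j) ->
  M l l = 0 -> (M *m P *m M) l l = 0.
Proof.
move=> pM Ml; rewrite mxE big1// => i _.
by rewrite (psd_diag_eq0 _ _ _ pM Ml) mulr0.
Qed.

End Projection.

(** * Residual kernels and Nystrom weights *)

Section Residual.
Context {R : realType} {X : finType} {n : nat}.
Variables (k : X -> X -> R) (pt : 'I_n -> X).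
Hypothesis psdk : psd k.
Implicit Types (S : seq 'I_n).

Let kern (i j : 'I_n) := k (pt i) (pt j).

Definition residual S : X -> X -> R := foldl (fun k l => reduce k (pt l)) k S.

Lemma residual_rcons S l : residual (rcons S l) = reduce (residual S) (pt l).
Proof. by rewrite /residual foldl_rcons. Qed.

Lemma psd_residual S : psd (residual S).
Proof.
by elim/last_ind: S => [//|S l IH]; rewrite residual_rcons; exact: psd_reduce.
Qed.

Lemma residual_diag_le S x : residual S x x <= k x x.
Proof.
elim/last_ind: S => [//|S l IH]; rewrite residual_rcons (le_trans _ IH)//.
exact: reduce_diag_le (psd_residual S).
Qed.

(* The pivot sequences that the sampling reaches with positive probability. *)
Inductive admissible : seq 'I_n -> Prop :=
| admissible_nil : admissible [::]
| admissible_rcons S l : admissible S -> residual S (pt l) (pt l) != 0 ->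
    admissible (rcons S l).

Lemma residual_pivot S l y : admissible S -> l \in S -> residual S (pt l) y = 0.
Proof.
move=> aS; elim: aS l y => {S}[//|S j aS IH j0] l y.
rewrite mem_rcons inE residual_rcons => /predU1P[->|lS].
  exact: reduce_pivot.
by rewrite /reduce !(IH l) // !mul0r subr0.
Qed.

Lemma admissible_uniq S : admissible S -> uniq S.
Proof.
elim=> {S}[//|S j aS IH j0]; rewrite rcons_uniq IH andbT.
by apply: contra j0 => jS; rewrite residual_pivot.
Qed.

(** The residual differs from [k] by a combination of pivot columns whose coefficients do not depend
    on [x]; vanishing at the pivots will identify them with the Nystrom weights. *)
Lemma residual_coef S : admissible S ->
  exists c : 'I_n -> X -> R, forall x y,
    residual S x y = k x y - \sum_(l <- S) k x (pt l) * c l y.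
Proof.
elim=> {S}[|S j aS [c Hc] j0]; first by exists (fun _ _ => 0) => x y; rewrite big_nil subr0.
pose rho y := residual S (pt j) y / residual S (pt j) (pt j).
(* Eliminating [j] subtracts [rho y] times the residual column of [j], which itself involves the
   earlier pivots through [c l (pt j)]. *)
exists (fun l y => if l == j then rho y else c l y - c l (pt j) * rho y) => x y.
have jS : j \notin S.
  by apply: contra j0 => jS; rewrite residual_pivot.
rewrite residual_rcons /reduce -mulrA -/(rho y) !Hc -cats1 big_cat/= big_seq1 eqxx.
have -> : \sum_(l <- S) k x (pt l) * (if l == j then rho y else c l y - c l (pt j) * rho y)
  = \sum_(l <- S) (k x (pt l) * c l y - k x (pt l) * c l (pt j) * rho y).
  apply: eq_big_seq => l lS; case: eqP => [lj|_]; first by rewrite -lj lS in jS.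
  by rewrite mulrBr mulrA.
by rewrite sumrB -mulr_suml; ring.
Qed.

(* Pairing u with the residual column of the last pivot, which vanishes on all
   earlier pivots, isolates the last coefficient of u. *)
Lemma admissible_free S (u : 'I_n -> R) : admissible S ->
  (forall y, y \in S -> \sum_(l <- S) u l * kern l y = 0) ->
  forall l, l \in S -> u l = 0.
Proof.
move=> aS; elim: aS u => {S}[//|S j aS IH j0] u Hu.
have [c Hc] := residual_coef S aS.
have [sr _] := psd_residual S.
have uj : u j = 0.
  have : \sum_(l <- rcons S j) u l * residual S (pt l) (pt j) = 0.
    under eq_bigr => l _ do rewrite Hc mulrBr mulr_sumr.
    rewrite sumrB Hu ?mem_rcons ?mem_head// sub0r exchange_big big_seq big1 ?oppr0//= => i iS.
    under eq_bigr => l _ do rewrite mulrA.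
    by rewrite -mulr_suml Hu ?mul0r// mem_rcons inE iS orbT.
  rewrite -cats1 big_cat big_seq1 /= big_seq big1 ?add0r => [/eqP|l lS].
    by rewrite mulf_eq0 (negbTE j0) orbF => /eqP.
  by rewrite residual_pivot ?mulr0.
move=> l; rewrite mem_rcons inE => /predU1P[->//|lS]; apply: (IH) => // y yS.
have := Hu y; rewrite mem_rcons inE yS orbT -cats1 big_cat big_seq1 /= uj mul0r addr0.
exact.
Qed.

(** The pivots are distinct, so a null vector of the Gram matrix is a function [u] on pivots, and
    [admissible_free] kills it. *)
Lemma KSS_unit S : admissible S -> KSS kern S \in unitmx.
Proof.
move=> aS; rewrite -row_free_unit -kermx_eq0; apply/rowV0P => v /sub_kermxP vK.
have piv_inj : injective (@piv n S).
  move=> s t; rewrite /piv !(tnth_nth (piv s)) /= => /eqP.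
  by rewrite nth_uniq ?admissible_uniq// => /eqP/val_inj.
pose u l := \sum_t (piv t == l)%:R * v 0 t.
have upiv s : u (piv s) = v 0 s.
  by rewrite -[RHS](sum_delta (fun t => v 0 t)); apply: eq_bigr => t _; rewrite (inj_eq piv_inj).
apply/rowP => t; rewrite mxE -upiv; apply: (admissible_free S) => //; last exact: mem_tnth.
move=> y /seq_tnthP[s ->]; rewrite big_tnth.
move/rowP: vK => /(_ s); rewrite !mxE => vK; rewrite -[RHS]vK.
by apply: eq_bigr => i _; rewrite -/(piv i) upiv mxE.
Qed.

(** At pivots the residual vanishes, so the coefficients of [residual_coef] solve the linear system
    defining [nysW]. The point [x] is arbitrary because queries will be substituted for it. *)
Lemma residual_nysW S x l : admissible S ->
  residual S x (pt l) = k x (pt l) - \sum_t k x (pt (@piv n S t)) * nysW kern S t l.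
Proof.
move=> aS; have [c Hc] := residual_coef S aS.
have -> : nysW kern S = \matrix_(t, l) c (@piv n S t) (pt l).
  rewrite -[RHS](mulKmx (KSS_unit S aS)); congr (_ *m _).
  apply/matrixP => s i; rewrite !mxE.
  have := Hc (pt (piv s)) (pt i); rewrite residual_pivot ?mem_tnth// => /esym/eqP.
  rewrite subr_eq0 => /eqP; rewrite -/(kern _ _) => ->.
  by rewrite big_tnth; apply: eq_bigr => t _; rewrite !mxE.
by rewrite Hc big_tnth; congr (_ - _); apply: eq_bigr => t _; rewrite mxE.
Qed.

Lemma resdiag_residual S l : admissible S -> resdiag kern S l = residual S (pt l) (pt l).
Proof.
move=> aS; rewrite residual_nysW// /resdiag -mulmxA mxE; congr (_ - _).
apply: eq_bigr => t _; rewrite mxE; congr (_ * _).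
by rewrite /nysW !mxE; apply: eq_bigr => s _; rewrite !mxE.
Qed.

End Residual.

(** * Decay of the residual trace under random pivoting *)

Section Decay.
Context {R : realType}.
(* The recursion is dominated by the flow a' = - a^2 / (k (a + b)), along which
   ln a - b / a decreases at rate 1 / k. *)
Variables (a : nat -> R) (b k : R).
Hypothesis b0 : 0 < b.
Hypothesis k0 : 0 < k.
Hypothesis a0 : forall j, 0 <= a j.
Hypothesis aS : forall j, a j.+1 <= a j - a j ^+ 2 / (k * (a j + b)).

Lemma decay_mono j : a j.+1 <= a j.
Proof.
rewrite (le_trans (aS j))// gerBl divr_ge0 ?sqr_ge0// mulr_ge0 ?ltW//.
by rewrite ltr_wpDl.
Qed.

(** For consecutive values [u] and [v], the two terms change by at most [v / u - 1] and
    [- (b * (u - v) / u ^+ 2)]. These add up to [- ((u - v) * (u + b) / u ^+ 2)], at most [- k^-1]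
    by the recursion. *)
Lemma decay_potential r : 0 < a r ->
  ln (a r) - b / a r <= ln (a 0%N) - b / a 0%N - r%:R / k.
Proof.
elim: r => [|r IH] ar1; first by rewrite mul0r subr0.
have le1 := decay_mono r.
have ar : 0 < a r by exact: lt_le_trans ar1 le1.
have IHr := IH ar; have h := aS r; move: IHr ar1 le1 ar h.
move: (a r) (a r.+1) => u v {}IH v0 vu u0 h.
have lnuv : ln v - ln u <= v / u - 1.
  rewrite -ln_div ?posrE//.
  have := @le_ln1Dx R (v / u - 1); rewrite [1 + _]addrC subrK; apply.
  by rewrite ltrBrDr addrC subrr divr_gt0.
have hb : b / u - b / v <= - (b * (u - v) / u ^+ 2).
  have -> : b / u - b / v = - (b * (u - v) / u) * v^-1.
    by field; rewrite !gt_eqF.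
  have -> : - (b * (u - v) / u ^+ 2) = - (b * (u - v) / u) * u^-1.
    by field; rewrite !gt_eqF.
  rewrite !mulNr lerN2 ler_wpM2l ?lef_pV2 ?posrE//.
  by rewrite divr_ge0 ?mulr_ge0 ?subr_ge0// ltW.
have hk : k^-1 <= (u - v) * (u + b) / u ^+ 2.
  have {}h : u ^+ 2 / (k * (u + b)) <= u - v by rewrite lerBrDl -lerBrDr.
  rewrite ler_pdivrMr ?mulr_gt0 ?addr_gt0// in h.
  by rewrite ler_pdivlMr ?exprn_gt0// ler_pdivrMl// mulrCA.
have e : (u - v) * (u + b) / u ^+ 2 = 1 - v / u + b * (u - v) / u ^+ 2.
  by field; rewrite gt_eqF.
rewrite -natr1 mulrDl mul1r.
rewrite e in hk.
lra.
Qed.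

(** If [a r] exceeded [3 / 2 * T], the potential would give [ln (3 / 2) < b / a r < 1 / 3], while
    [ln (3 / 2)] is at least 1/3. *)
Lemma decay_bound (T : R) r : b <= T / 2 -> a 0%N * expR (- (r%:R / k)) <= T ->
  a r <= 3 / 2 * T.
Proof.
move=> bT aT; rewrite leNgt; apply/negP => h.
have T0 : 0 < T by have := lt_le_trans b0 bT; lra.
have ar : 0 < a r by apply: lt_trans h; rewrite mulr_gt0.
have p := decay_potential r ar.
have a00 : 0 < a 0%N.
  by elim: {p aT h} r ar => // r IH ar; apply: IH; exact: lt_le_trans (decay_mono r).
have l1 : ln (3 / 2 * T) < ln (a r) by rewrite ltr_ln ?posrE// mulr_gt0.
rewrite lnM ?posrE// in l1.
have l2 : ln (a 0%N) - r%:R / k <= ln T.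
  rewrite -[X in _ - X]opprK opprK -[X in _ + X <= _]expRK -lnM ?posrE ?expR_gt0//.
  by rewrite ler_ln ?posrE// mulr_gt0 ?expR_gt0.
have l3 : 3^-1 <= ln (3 / 2 : R).
  rewrite -ler_expR lnK ?posrE//.
  have := expR_ge1Dx (- 3^-1 : R); rewrite expRN.
  have := expR_gt0 (3^-1 : R); set E := expR _ => E0 h1.
  have {}h1 : 2 / 3 <= E^-1 by lra.
  rewrite -(invrK E) -[leRHS]invrK lef_pV2 ?posrE ?invr_gt0//.
  lra.
have l4 : b / a r < 3^-1.
  rewrite ltr_pdivrMr//; lra.
have l5 : 0 <= b / a 0%N by rewrite divr_ge0 ?ltW.
lra.
Qed.

(** Already the first step leads to at most [a 0 * b / (a 0 + b)]. This covers Taylor degree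
    zero. *)
Lemma decay_rank1 r : k = 1 -> (0 < r)%N -> a r <= b.
Proof.
move=> k1; elim: r => // -[_ _|r IH _]; last exact: le_trans (decay_mono _) (IH _).
apply: le_trans (aS 0) _; rewrite k1 mul1r.
have p : 0 < a 0%N + b by rewrite ltr_wpDl.
have -> : a 0%N - a 0%N ^+ 2 / (a 0%N + b) = a 0%N * b / (a 0%N + b).
  by field; rewrite gt_eqF.
by rewrite ler_pdivrMr// mulrC ler_wpM2l ?lerDl// ltW.
Qed.

End Decay.

(** * Expectations over random pivots *)

Section Pivoting.
Context {R : realType} {X : finType} {n : nat}.
Variables (k : X -> X -> R) (pt : 'I_n -> X).
Hypothesis psdk : psd k.
Variable bin : pred 'I_n.
Implicit Types (S : seq 'I_n) (f g : seq 'I_n -> R).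

Let kern (i j : 'I_n) := k (pt i) (pt j).

Definition restrace S := \sum_(l < n | bin l) residual k pt S (pt l) (pt l).

Lemma restrace_ge0 S : 0 <= restrace S.
Proof. by apply: sumr_ge0 => l _; exact: psd_diag_ge0 (psd_residual _ _ psdk S). Qed.

Lemma rpExpectS r S f : admissible k pt S -> rpExpect kern bin r.+1 S f =
  if restrace S == 0 then f S else
  \sum_(l < n | bin l) residual k pt S (pt l) (pt l) / restrace S *
    rpExpect kern bin r (rcons S l) f.
Proof.
move=> aS /=.
under eq_bigr => l _ do rewrite resdiag_residual//.
rewrite -/(restrace S); case: ifP => // _.
by under eq_bigr => l _ do rewrite resdiag_residual//.
Qed.

(** Branches on which [Inv] may fail have weight zero, so the comparison is needed only under
    [Inv]. *)
Lemma rpExpect_le (Inv : seq 'I_n -> Prop) r S f g :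
  (forall S, Inv S -> admissible k pt S) ->
  (forall S l, Inv S -> bin l -> residual k pt S (pt l) (pt l) != 0 -> Inv (rcons S l)) ->
  Inv S -> (forall S, Inv S -> f S <= g S) ->
  rpExpect kern bin r S f <= rpExpect kern bin r S g.
Proof.
move=> Ia Ir + fg; elim: r S => [S IS|r IH S IS]; first exact: fg.
rewrite !rpExpectS; [|exact: Ia..]; case: ifP => [_|_]; first exact: fg.
apply: ler_sum => l bl.
have [->|r0] := eqVneq (residual k pt S (pt l) (pt l)) 0.
  by rewrite !mul0r.
apply: ler_wpM2l; last exact: IH (Ir _ _ IS bl r0).
by rewrite divr_ge0 ?restrace_ge0// (psd_diag_ge0 _ _ (psd_residual _ _ psdk S)).
Qed.

Lemma rpExpect_cst r S (c : R) : rpExpect kern bin r S (fun=> c) = c.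
Proof.
elim: r S => //= r IH S; case: ifPn => // t0.
under eq_bigr => l _ do rewrite IH.
by rewrite -mulr_suml -mulr_suml divff// mul1r.
Qed.

Lemma rpExpect_linear r S (c : R) f g :
  rpExpect kern bin r S (fun S => c * f S + g S) =
  c * rpExpect kern bin r S f + rpExpect kern bin r S g.
Proof.
elim: r S => //= r IH S; case: ifPn => // t0.
under eq_bigr => l _ do rewrite IH.
by rewrite mulr_sumr -big_split/=; apply: eq_bigr => l _; ring.
Qed.

(** Splits off the last pivot instead of the first. After an early stop the residual trace is zero,
    so a further step changes nothing. *)
Lemma rpExpectSr r S f : rpExpect kern bin r.+1 S f =
  rpExpect kern bin r S (fun S' => rpExpect kern bin 1 S' f).
Proof.
elim: r S => // r IH S; rewrite [LHS]/= [RHS]/=.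
case: ifPn => [//|_].
by apply: eq_bigr => l _; rewrite -IH.
Qed.

(** Padding with zeros outside the bin keeps one matrix size for all bins. *)
Definition resmx S : 'M[R]_n :=
  \matrix_(i, j) ((bin i)%:R * (bin j)%:R * residual k pt S (pt i) (pt j)).

Lemma psd_resmx S : psd (fun i j => resmx S i j).
Proof.
have := psd_pullback _ pt (fun i => (bin i)%:R) (psd_residual _ pt psdk S).
have e i j : resmx S i j = (bin i)%:R * (bin j)%:R * residual k pt S (pt i) (pt j).
  by rewrite mxE.
move=> [h1 h2]; split=> [x y|v]; rewrite ?e; first exact: h1.
by under eq_bigr => x _ do under eq_bigr => y _ do rewrite e; exact: h2.
Qed.

Lemma resmx_rcons S l : bin l -> resmx (rcons S l) = mxreduce _ (resmx S) l.
Proof.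
move=> bl; apply/matrixP => i j; rewrite /mxreduce mxE [RHS]mxE residual_rcons /reduce !mxE bl.
by rewrite !mul1r mulr1; ring.
Qed.

Lemma restraceE S : restrace S = \tr (resmx S).
Proof.
rewrite /restrace big_mkcond /=; apply: eq_bigr => i _; rewrite mxE.
by case: (bin i); rewrite ?mul1r// !mul0r.
Qed.

Lemma rpExpect_proj_step (P : 'M[R]_n) (q : R) S : orthoproj _ P -> \tr P <= q -> 0 < q ->
  admissible k pt S ->
  rpExpect kern bin 1 S (fun S => \tr (P *m resmx S)) <=
  \tr (P *m resmx S) - \tr (P *m resmx S) ^+ 2 / (q * restrace S).
Proof.
move=> hP Pq q0 aS; rewrite rpExpectS//=; case: eqP => [->|/eqP t0].
  by rewrite mulr0 invr0 mulr0 subr0.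
have pM := psd_resmx S; have tM := psd_mx_sym pM.
set M := resmx S in pM tM *; set t := restrace S in t0 *.
have tp : 0 < t by rewrite lt0r t0 restrace_ge0.
have e l : bin l -> residual k pt S (pt l) (pt l) = M l l.
  by move=> bl; rewrite /M mxE bl !mul1r.
have -> : \sum_(l < n | bin l) residual k pt S (pt l) (pt l) / t * \tr (P *m resmx (rcons S l))
   = \tr (P *m M) - \tr (M *m P *m M) / t.
  transitivity (\sum_(l < n | bin l) (residual k pt S (pt l) (pt l) * (\tr (P *m M) / t)
      - (M *m P *m M) l l / t)).
    apply: eq_bigr => l bl; rewrite resmx_rcons// proj_trace_reduce -/M e//.
    have [m0|m0] := eqVneq (M l l) 0; last by field; rewrite m0 t0.
    by rewrite m0 (proj_sandwich_diag_eq0 _ _ _ _ pM)// !mul0r subr0.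
  rewrite sumrB -mulr_suml -/(restrace S) -/t mulrCA divff// mulr1; congr (_ - _).
  rewrite -mulr_suml; congr (_ / _); rewrite big_mkcond/=; apply: eq_bigr => l _.
  (* Outside the bin the columns of [M] vanish, so the sum over the bin is the full trace. *)
  case: ifPn => // bl; rewrite mxE big1// => i _.
  by rewrite /M [X in _ * X]mxE (negbTE bl) mulr0 mul0r mulr0.
rewrite lerD2l lerN2 invfM mulrA ler_pM2r ?invr_gt0// ler_pdivrMr//.
apply: le_trans (proj_trace_cauchy _ _ _ hP tM) _.
rewrite mulrC ler_wpM2l//.
by apply: sumr_ge0 => l _; exact: proj_sandwich_diag_ge0.
Qed.

Variables (P : 'M[R]_n) (q b : R).
Hypothesis hP : orthoproj _ P.
Hypothesis trP : \tr P <= q.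
Hypothesis q0 : 0 < q.
Hypothesis b0 : 0 < b.
Hypothesis tail : \tr ((1%:M - P) *m resmx [::]) <= b.

Let Inv S := admissible k pt S /\ \tr ((1%:M - P) *m resmx S) <= b.

Let InvW S : Inv S -> admissible k pt S. Proof. by case. Qed.

(** The high-degree part never increases: every pivot subtracts a nonnegative diagonal entry of the
    sandwich. *)
Let Inv_rcons S l : Inv S -> bin l -> residual k pt S (pt l) (pt l) != 0 -> Inv (rcons S l).
Proof.
move=> [aS Sb] bl r0; split; first exact: admissible_rcons.
have pM := psd_resmx S; have tM := psd_mx_sym pM.
rewrite resmx_rcons// proj_trace_reduce (le_trans _ Sb)// gerBl divr_ge0//.
  exact: proj_sandwich_diag_ge0 (orthoproj_compl _ _ hP) tM.
exact: (psd_diag_ge0 _ l pM).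
Qed.

Let Inv_nil : Inv [::]. Proof. by split=> //; exact: admissible_nil. Qed.

Let alpha S := \tr (P *m resmx S).

Lemma alpha_ge0 S : 0 <= alpha S.
Proof. exact: proj_trace_ge0 hP (psd_resmx S). Qed.

Lemma restrace_split S : restrace S = alpha S + \tr ((1%:M - P) *m resmx S).
Proof.
by rewrite restraceE /alpha mulmxBl mul1mx linearB/= addrC subrK.
Qed.

Let a r := rpExpect kern bin r [::] alpha.

(** The one-step bound holds for each pivot sequence; averaging it is Jensen's inequality for
    [alpha ^+ 2 / (alpha + b)], done by a tangent. *)
Lemma rpExpect_alpha_rec r : a r.+1 <= a r - a r ^+ 2 / (q * (a r + b)).
Proof.
have a0 : 0 <= a r.
  rewrite -(rpExpect_cst r [::] 0); apply: (rpExpect_le Inv) => // S _; exact: alpha_ge0.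
rewrite /a rpExpectSr -/(a r).
have ab : a r + b != 0 by rewrite gt_eqF// ltr_wpDl.
(* With this slope [2 * t * alpha - t ^+ 2 * (alpha + b)] agrees with the quotient at
   [alpha = a r]. *)
pose t := a r / (a r + b).
have -> : a r - a r ^+ 2 / (q * (a r + b)) =
    (1 - (2 * t - t ^+ 2) / q) * a r + t ^+ 2 * b / q.
  by rewrite /t; field; rewrite ab gt_eqF.
rewrite -(rpExpect_cst r [::] (t ^+ 2 * b / q)) -rpExpect_linear.
apply: (rpExpect_le Inv) => // S [aS Sb].
apply: le_trans (rpExpect_proj_step _ _ _ hP trP q0 aS) _; rewrite -/(alpha S).
have al0 := alpha_ge0 S.
have ts := restrace_split S; have t0 := restrace_ge0 S.
have B0 := proj_trace_ge0 _ _ _ (orthoproj_compl _ _ hP) (psd_resmx S).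
set tS := restrace S in ts t0 *.
(* Tangent bound for the convex perspective alpha^2 / (alpha + b) at its mean. *)
have h : 2 * t * alpha S - t ^+ 2 * (alpha S + b) <= alpha S ^+ 2 / tS.
  have [tS0|tS0] := eqVneq tS 0.
    rewrite tS0 invr0 mulr0; have -> : alpha S = 0 by lra.
    by rewrite mulr0 add0r sub0r oppr_le0 mulr_ge0 ?sqr_ge0// ltW.
  have tSp : 0 < tS by rewrite lt0r tS0.
  apply: (@le_trans _ _ (2 * t * alpha S - t ^+ 2 * tS)).
    by rewrite lerD2l lerN2 ler_wpM2l ?sqr_ge0//; lra.
  rewrite ler_pdivlMr// -subr_ge0.
  have -> : alpha S ^+ 2 - (2 * t * alpha S - t ^+ 2 * tS) * tS = (alpha S - t * tS) ^+ 2.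
    ring.
  exact: sqr_ge0.
have q'0 : 0 <= q^-1 by rewrite invr_ge0 ltW.
rewrite invfM (mulrCA _ q^-1).
have -> : (1 - (2 * t - t ^+ 2) / q) * alpha S + t ^+ 2 * b / q =
  alpha S - q^-1 * (2 * t * alpha S - t ^+ 2 * (alpha S + b)) by ring.
by rewrite lerD2l lerN2 ler_wpM2l.
Qed.

(** The low-degree part contributes at most [3 / 2 * T] and the tail [T / 2]. *)
Lemma rpExpect_restrace r (T A : R) : b <= T / 2 -> restrace [::] <= A ->
  (q = 1 /\ (0 < r)%N) \/ A * expR (- (r%:R / q)) <= T ->
  rpExpect kern bin r [::] restrace <= 2 * T.
Proof.
move=> bT rA H; have T0 := lt_le_trans b0 bT.
have a0 j : 0 <= a j.
  rewrite -(rpExpect_cst j [::] 0); apply: (rpExpect_le Inv) => // S _; exact: alpha_ge0.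
have arT : a r <= 3 / 2 * T.
  case: H => [[q1 r0]|H].
    apply: (@le_trans _ _ b); last lra.
    by apply: (decay_rank1 _ _ _ b0 q0 a0 rpExpect_alpha_rec).
  apply: (decay_bound _ _ _ b0 q0 a0 rpExpect_alpha_rec) => //.
  apply: le_trans H; rewrite ler_wpM2r ?expR_ge0// (le_trans _ rA)//.
  rewrite restrace_split lerDl.
  exact: proj_trace_ge0 _ _ _ (orthoproj_compl _ _ hP) (psd_resmx [::]).
apply: (@le_trans _ _ (a r + b)); last lra.
rewrite -[a r]mul1r -[X in _ + X](rpExpect_cst r [::] b) -rpExpect_linear.
apply: (rpExpect_le Inv) => // S [_ Sb].
by rewrite mul1r restrace_split lerD2l.
Qed.

End Pivoting.

(** * The exponential kernel *)

Lemma psd_gram {R : realFieldType} {X I : finType} (w : I -> R) (F : I -> X -> R) :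
  (forall i, 0 <= w i) -> psd (fun x y => \sum_i w i * (F i x * F i y)).
Proof.
move=> w0; split=> [x y|v]; first by apply: eq_bigr => i _; rewrite (mulrC (F i x)).
have -> : \sum_x \sum_y v x * v y * (\sum_i w i * (F i x * F i y)) =
    \sum_i w i * (\sum_x v x * F i x) ^+ 2.
  under eq_bigr => x _ do under eq_bigr => y _ do rewrite mulr_sumr.
  under eq_bigr => x _ do rewrite exchange_big /=.
  rewrite exchange_big /=; apply: eq_bigr => i _.
  rewrite expr2 mulr_suml mulr_sumr; apply: eq_bigr => x _.
  by rewrite mulr_sumr mulr_sumr; apply: eq_bigr => y _; ring.
by apply: sumr_ge0 => i _; rewrite mulr_ge0 ?sqr_ge0.
Qed.

Section ExpTail.
Context {R : realType}.
Implicit Types (u x : R) (N : nat).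

Definition exp_tail N u : R := expR u - series (exp_coeff u) N.

Lemma exp_coeff_sumE u N : series (exp_coeff u) N = \sum_(p < N) u ^+ p / p`!%:R.
Proof. by rewrite /series/= big_mkord. Qed.

Lemma exp_tail_cvg N u :
  (series (exp_coeff u) M - series (exp_coeff u) N @[M --> \oo] --> exp_tail N u)%classic.
Proof. by apply: cvgB; [exact: is_cvg_series_exp_coeff|exact: cvg_cst]. Qed.

(** Beyond index [N.+1], consecutive Taylor terms have ratio at most [x / N.+1%:R]. *)
Lemma exp_coeff_geometric x N j : 0 <= x ->
  exp_coeff x (N.+1 + j)%N <= x ^+ N.+1 / N.+1`!%:R * (x / N.+1%:R) ^+ j.
Proof.
move=> x0; elim: j => [|j IH]; first by rewrite addn0 expr0 mulr1.
have -> : x ^+ N.+1 / N.+1`!%:R * (x / N.+1%:R) ^+ j.+1 =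
    x ^+ N.+1 / N.+1`!%:R * (x / N.+1%:R) ^+ j * (x / N.+1%:R).
  by rewrite [_ ^+ j.+1]exprSr mulrA.
apply: (@le_trans _ _ (exp_coeff x (N.+1 + j)%N * (x / N.+1%:R))); last first.
  by rewrite ler_wpM2r// divr_ge0.
rewrite addnS /exp_coeff /= exprSr factS natrM invfM.
have h : ((N.+1 + j).+1%:R^-1 : R) <= N.+1%:R^-1.
  by rewrite lef_pV2 ?posrE ?ltr0n// ler_nat -addnS leq_addr.
have := ler_wpM2l (mulr_ge0 (mulr_ge0 (exprn_ge0 (N.+1 + j)%N x0)
  (etrans (invr_ge0 _) (ler0n R (N.+1 + j)`!))) x0) h.
by congr (_ <= _); rewrite /=; ring.
Qed.

Lemma exp_tail_le x N : 0 <= x -> x < N.+1%:R ->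
  exp_tail N.+1 x <= x ^+ N.+1 / N.+1`!%:R / (1 - x / N.+1%:R).
Proof.
move=> x0 xN.
set T := x ^+ N.+1 / _; set q := x / _.
have T0 : 0 <= T by rewrite divr_ge0 ?exprn_ge0.
have q0 : 0 <= q by rewrite divr_ge0.
have q1 : q < 1 by rewrite ltr_pdivrMr ?mul1r// ltr0n.
have q1' : 0 < 1 - q by lra.
have key j : series (exp_coeff x) (N.+1 + j)%N - series (exp_coeff x) N.+1 <=
    T / (1 - q) * (1 - q ^+ j).
  elim: j => [|j IH]; first by rewrite addn0 expr0 !subrr mulr0.
  have -> : series (exp_coeff x) (N.+1 + j.+1)%N =
      series (exp_coeff x) (N.+1 + j)%N + exp_coeff x (N.+1 + j)%N.
    by rewrite addnS /series/= big_nat_recr.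
  have := exp_coeff_geometric x N j x0; rewrite -/T -/q => h.
  have -> : T / (1 - q) * (1 - q ^+ j.+1) = T / (1 - q) * (1 - q ^+ j) + T * q ^+ j.
    by rewrite exprSr; field; rewrite gt_eqF.
  by rewrite addrAC lerD.
rewrite -(cvg_lim _ (exp_tail_cvg N.+1 x))//.
apply: limr_le; first exact: cvgP (exp_tail_cvg N.+1 x).
near=> M.
have NM : (N.+1 <= M)%N by near: M; exact: nbhs_infty_ge.
rewrite -(subnKC NM); apply: le_trans (key _) _.
apply: ler_piMr; first by rewrite divr_ge0// ltW.
by rewrite lerBlDr lerDl exprn_ge0.
Unshelve. all: by end_near. Qed.

(** Induction through [(1 + 1 / N) ^ N <= e]. The saved factor e becomes the [expR (- 1)] of
    [exp_tail_chernoff], which later pays for the geometric sum. *)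
Lemma fact_stirling_le N : (0 < N)%N ->
  (N%:R : R) ^+ N <= N`!%:R * expR (N%:R - 1).
Proof.
case: N => // N _; elim: N => [|N IH]; first by rewrite subrr expR0 mulr1 expr1.
have h : (N.+2%:R : R) ^+ N.+1 <= N.+1%:R ^+ N.+1 * expR 1.
  have -> : (N.+2%:R : R) = N.+1%:R * (1 + N.+1%:R^-1).
    by rewrite mulrDr mulr1 divff ?pnatr_eq0// natr1.
  rewrite exprMn ler_wpM2l ?exprn_ge0//.
  have -> : expR 1 = expR (N.+1%:R^-1 : R) ^+ N.+1.
    by rewrite -expRM_natr mulVf ?pnatr_eq0.
  by rewrite lerXn2r ?nnegrE ?expR_ge0 ?addr_ge0 ?invr_ge0// expR_ge1Dx.
rewrite exprS factS natrM -mulrA ler_wpM2l//.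
apply: le_trans h _.
have -> : expR (N.+2%:R - 1) = expR (N.+1%:R - 1) * expR 1 :> R.
  by rewrite -expRD subrK -[N.+2%:R]natr1 addrK.
by rewrite mulrA ler_wpM2r ?expR_ge0.
Qed.

Lemma exp_tail_chernoff u x N : 0 <= u <= x -> x < N.+1%:R ->
  exp_tail N.+1 u <= (expR 1 * x / N.+1%:R) ^+ N.+1 * expR (- 1) / (1 - x / N.+1%:R).
Proof.
move=> /andP[u0 ux] xN; have uN := le_lt_trans ux xN.
have x0 := le_trans u0 ux.
have N0 : (0 : R) < N.+1%:R by rewrite ltr0n.
have q1 : 0 < 1 - x / N.+1%:R by rewrite subr_gt0 ltr_pdivrMr ?mul1r.
have q2 : 0 < 1 - u / N.+1%:R by rewrite subr_gt0 ltr_pdivrMr ?mul1r.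
apply: le_trans (exp_tail_le _ _ u0 uN) _.
apply: ler_pM; [by rewrite divr_ge0 ?exprn_ge0|by rewrite invr_ge0 ltW| |]; last first.
  by rewrite lef_pV2 ?posrE// lerD2l lerN2 ler_wpM2r.
apply: (@le_trans _ _ (x ^+ N.+1 / N.+1`!%:R)).
  by rewrite ler_wpM2r ?invr_ge0 ?ler0n// lerXn2r ?nnegrE.
rewrite ler_pdivrMr ?ltr0n ?fact_gt0//.
have -> : (expR 1 * x / N.+1%:R) ^+ N.+1 * expR (-1) * N.+1`!%:R =
    x ^+ N.+1 * (N.+1`!%:R * expR (N.+1%:R - 1) / N.+1%:R ^+ N.+1).
  rewrite !exprMn exprVn expRD -[X in expR X * expR (- 1)]mul1r expRM_natr; ring.
by rewrite ler_peMr ?exprn_ge0// ler_pdivlMr ?exprn_gt0// mul1r fact_stirling_le.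
Qed.

End ExpTail.

(** * Monomials of bounded degree *)

Section Monomial.
Context {R : realType} {d : nat}.
Implicit Types (p q : 'rV[R]_d).

(* Index [ord0] stands for the constant 1, so tuples of length s encode the
   monomials of degree at most s. *)
Definition monomial (t : seq 'I_d.+1) (p : 'rV[R]_d) : R :=
  \prod_(i <- t) (if unlift ord0 i is Some j then p 0 j else 1).

Definition sorted_tuples s : {set s.-tuple 'I_d.+1} :=
  [set t : s.-tuple 'I_d.+1 | sorted leq [seq \val i | i <- t]].

(** Pad the word [f] with constants up to length [s] and sort. Sorted tuples list every monomial
    once, and there are ['C(s + d, s)] of them. *)
Lemma monomial_sorted s (f : seq 'I_d) : (size f <= s)%N ->
  exists2 t, t \in sorted_tuples s & forall p, monomial t p = \prod_(j <- f) p 0 j.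
Proof.
move=> fs.
pose t0 := map (lift ord0) f ++ nseq (s - size f) ord0.
pose t1 := sort (fun i j : 'I_d.+1 => (i <= j)%N) t0.
have st : size t1 == s.
  by rewrite size_sort size_cat size_map size_nseq subnKC.
exists (Tuple st).
  rewrite inE /= sorted_map; apply: sort_sorted => i j; exact: leq_total.
move=> p; rewrite /monomial /= (perm_big t0) ?perm_sort// big_cat big_map /=.
rewrite [X in _ * X]big1_seq ?mulr1 => [|i /andP[_]].
  by apply: eq_bigr => j _; rewrite liftK.
by rewrite mem_nseq => /andP[_ /eqP ->]; rewrite unlift_none.
Qed.

(** Expanding over words rather than exponents avoids multinomial coefficients. *)
Lemma dotr_pow p q e :
  dotr p q ^+ e = \sum_(f : {ffun 'I_e -> 'I_d})
     (\prod_(j <- codom f) p 0 j) * (\prod_(j <- codom f) q 0 j).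
Proof.
rewrite -[e in LHS]card_ord -prodr_const /dotr bigA_distr_bigA /=.
apply: eq_bigr => f _.
by rewrite codomE !big_map -big_split /= -enumT big_enum.
Qed.

End Monomial.

Section ExpKernel.
Context {R : realType} {X : finType} {d : nat}.
Variables (pts : X -> 'rV[R]_d) (c : R).
Hypothesis c0 : 0 <= c.

Definition inner x y : R := c * dotr (pts x) (pts y).
Definition exp_kernel x y : R := expR (inner x y).

Lemma psd_inner_pow e (w : R) : 0 <= w -> psd (fun x y => inner x y ^+ e * w).
Proof.
move=> w0.
have := @psd_gram R X {ffun 'I_e -> 'I_d} (fun=> c ^+ e * w)
  (fun f x => \prod_(j <- codom f) pts x 0 j) (fun _ => mulr_ge0 (exprn_ge0 _ c0) w0).
have h x y : inner x y ^+ e * w = \sum_(f : {ffun 'I_e -> 'I_d}) c ^+ e * w *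
    ((\prod_(j <- codom f) pts x 0 j) * \prod_(j <- codom f) pts y 0 j).
  by rewrite -mulr_sumr -dotr_pow exprMn mulrAC.
move=> [h1 h2]; split=> [x y|v]; first by rewrite !h h1.
by under eq_bigr => x _ do under eq_bigr => y _ do rewrite h; exact: h2.
Qed.

Lemma psd_sum (I : Type) (r : seq I) (P : pred I) (F : I -> X -> X -> R) :
  (forall i, psd (F i)) -> psd (fun x y => \sum_(i <- r | P i) F i x y).
Proof.
move=> pF; split=> [x y|v].
  by apply: eq_bigr => i _; have [-> _] := pF i.
have -> : \sum_x \sum_y v x * v y * (\sum_(i <- r | P i) F i x y) =
   \sum_(i <- r | P i) \sum_x \sum_y v x * v y * F i x y.
  under eq_bigr => x _ do under eq_bigr => y _ do rewrite mulr_sumr.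
  under eq_bigr => x _ do rewrite exchange_big /=.
  by rewrite exchange_big.
by apply: sumr_ge0 => i _; have [_] := pF i; exact.
Qed.

(** The quadratic form is a limit of those of finite sums of powers of [inner], each nonnegative. *)
Lemma psd_exp_tail N : psd (fun x y => exp_tail N (inner x y)).
Proof.
have pp M : psd (fun x y => \sum_(N <= e < M) exp_coeff (inner x y) e).
  by apply: psd_sum => e; apply: psd_inner_pow; rewrite invr_ge0.
split=> [x y|v].
  by have [h _] := psd_inner_pow 1 1 ler01; have := h x y; rewrite !expr1 !mulr1 => ->.
have cv : ((\sum_x \sum_y v x * v y *
      (series (exp_coeff (inner x y)) M - series (exp_coeff (inner x y)) N))
    @[M --> \oo] --> \sum_x \sum_y v x * v y * exp_tail N (inner x y))%classic.
  apply: cvg_big => [|x _]; first exact: add_continuous.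
  apply: cvg_big => [|y _]; first exact: add_continuous.
  by apply: cvgM; [exact: cvg_cst|exact: exp_tail_cvg].
rewrite -(cvg_lim _ cv)//; apply: limr_ge; first exact: cvgP cv.
near=> M.
have NM : (N <= M)%N by near: M; exact: nbhs_infty_ge.
have [_ /(_ v)] := pp M; congr (0 <= _).
apply: eq_bigr => x _; apply: eq_bigr => y _; congr (_ * _).
by rewrite sub_series_geq.
Unshelve. all: by end_near. Qed.

Lemma psd_exp_kernel : psd exp_kernel.
Proof.
have [h1 h2] := psd_exp_tail 0.
have e x y : exp_tail 0 (inner x y) = exp_kernel x y.
  by rewrite /exp_tail /series/= big_geq// subr0.
split=> [x y|v]; first by rewrite -!e h1.
by under eq_bigr => x _ do under eq_bigr => y _ do rewrite -e; exact: h2.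
Qed.

(** [P] projects onto the monomial vectors of degree at most [s]. It fixes the Taylor polynomial
    [lo], so its complement sees only the tail [hi], which is positive semidefinite. *)
Lemma exp_kernel_lowrank n (pt : 'I_n -> X) (bin : pred 'I_n) s :
  exists P : 'M[R]_n, [/\ orthoproj _ P, \tr P <= ('C(s + d, s))%:R &
    \tr ((1%:M - P) *m resmx exp_kernel pt bin [::]) <=
    \sum_(l < n | bin l) exp_tail s.+1 (inner (pt l) (pt l))].
Proof.
pose g (t : seq 'I_d.+1) : 'cV[R]_n := \col_i ((bin i)%:R * monomial t (pts (pt i))).
have [P [hP trP Pg]] := orthoproj_span _ [seq g (val t) | t <- enum (@sorted_tuples d s)].
exists P; split=> //.
  by rewrite -card_sorted_tuples cardE -(size_map (fun t => g (val t))).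
pose hi : 'M[R]_n := \matrix_(i, j) ((bin i)%:R * (bin j)%:R * exp_tail s.+1 (inner (pt i) (pt j))).
pose lo : 'M[R]_n := \matrix_(i, j) ((bin i)%:R * (bin j)%:R *
   series (exp_coeff (inner (pt i) (pt j))) s.+1).
have -> : resmx exp_kernel pt bin [::] = lo + hi.
  by apply/matrixP => i j; rewrite !mxE /residual /= -mulrDr addrC subrK.
have Plo : P *m lo = lo.
  have -> : lo = \sum_(e < s.+1) \sum_(f : {ffun 'I_e -> 'I_d})
     (\col_i ((bin i)%:R * \prod_(j <- codom f) pts (pt i) 0 j)) *m
     (\row_i ((bin i)%:R * (c ^+ e / e`!%:R * \prod_(j <- codom f) pts (pt i) 0 j))).
    apply/matrixP => i j; rewrite mxE exp_coeff_sumE summxE mulr_sumr; apply: eq_bigr => e _.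
    rewrite summxE.
    transitivity (\sum_(f : {ffun 'I_e -> 'I_d}) (bin i)%:R * (bin j)%:R * (c ^+ e / e`!%:R) *
      ((\prod_(j <- codom f) pts (pt i) 0 j) * \prod_(l <- codom f) pts (pt j) 0 l)).
      rewrite -mulr_sumr -dotr_pow /inner exprMn; ring.
    apply: eq_bigr => f _.
    by rewrite mxE big_ord1 !mxE; ring.
  rewrite mulmx_sumr; apply: eq_bigr => e _; rewrite mulmx_sumr; apply: eq_bigr => f _.
  rewrite mulmxA; congr (_ *m _).
  have [|t ts tE] := monomial_sorted (R := R) s (codom f).
    by rewrite size_codom card_ord -ltnS.
  have -> : \col_i ((bin i)%:R * \prod_(j <- codom f) pts (pt i) 0 j) = g t.
    by apply/colP => i; rewrite !mxE tE.
  by apply: Pg; apply/mapP; exists t => //; rewrite mem_enum.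
rewrite mulmxDr mulmxBl mul1mx Plo subrr add0r mulmxBl mul1mx linearB/=.
have phi : psd (fun i j => hi i j).
  have [h1 h2] := psd_pullback _ pt (fun i => (bin i)%:R) (psd_exp_tail s.+1).
  have e i j : hi i j = (bin i)%:R * (bin j)%:R * exp_tail s.+1 (inner (pt i) (pt j)).
    by rewrite mxE.
  split=> [x y|v]; rewrite ?e; first exact: h1.
  by under eq_bigr => x _ do under eq_bigr => y _ do rewrite e; exact: h2.
apply: (@le_trans _ _ (\tr hi)).
  by rewrite gerBl; exact: proj_trace_ge0 hP phi.
rewrite [leRHS]big_mkcond; apply: ler_sum => i _; rewrite mxE.
by case: (bin i); rewrite ?mul1r// !mul0r.
Qed.

End ExpKernel.

(** * Growth exponents *)

Section Scalars.
Context {R : realType}.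

(** The intermediate value theorem on [[0, z]] gives a solution, so [xget] returns one, and its sign
    is that of [z]. *)
Lemma lambertW0P (z : R) : 0 < z -> 0 < lambertW0 z /\ lambertW0 z * expR (lambertW0 z) = z.
Proof.
move=> z0.
have [w wI wz] : exists2 w : R, w \in `[0, z] & w * expR w = z.
  apply: (IVT (f := fun w => w * expR w)); first exact: ltW.
    apply: continuous_subspaceT => x; apply: cvgM; first exact: cvg_id.
    exact: continuous_expR.
  have h : z <= z * expR z by rewrite ler_peMr ?ltW// expR_gt1.
  by rewrite mul0r min_l ?max_r ?h ?ltW// (lt_le_trans z0).
have [w1 wE] : -1 < lambertW0 z /\ lambertW0 z * expR (lambertW0 z) = z.
  apply: (@xgetPex _ 0 [set w : R | -1 < w /\ w * expR w = z]%classic).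
  exists w; split=> //; move: wI; rewrite in_itv /= => /andP[w0 _].
  by rewrite (lt_le_trans _ w0)// ltrN10.
split=> //; move: z0; rewrite -{1}wE pmulr_lgt0 ?expR_gt0//.
Qed.

Lemma rho0P : (0 : R) < rho0 /\ expR 2 <= rho0 ^+ 2 :> R.
Proof.
have z0 : 0 < 2 / expR 2 :> R by rewrite divr_gt0 ?expR_gt0.
have [w0 _] := lambertW0P _ z0.
have h : expR 2 <= 1 + expR (lambertW0 (2 / expR 2) + 2) :> R.
  by apply: ler_wpDl => //; rewrite ler_expR lerDr ltW.
have h0 : 0 < 1 + expR (lambertW0 (2 / expR 2) + 2) :> R by exact: lt_le_trans (expR_gt0 _) h.
by split; [rewrite /rho0 sqrtr_gt0|rewrite /rho0 sqr_sqrtr// ltW].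
Qed.

(* The three binomial probabilities at s - 1, s and s + 1 sum to at most 1, and
   each of the outer two is at least half of the middle one. *)
Lemma binomial_mode_le (s d : nat) : (0 < s)%N -> (0 < d)%N ->
  'C(s + d, s)%:R * ((s%:R / (s + d)%:R) ^+ s * (d%:R / (s + d)%:R) ^+ d) <= 2^-1 :> R.
Proof.
case: s => // s _; case: d => // d _.
set N := (s.+1 + d.+1)%N.
have N0 : (N%:R : R) != 0 by rewrite pnatr_eq0.
pose p : R := s.+1%:R / N%:R; pose q : R := d.+1%:R / N%:R.
rewrite -/p -/q.
have p0 : 0 <= p by rewrite divr_ge0.
have q0 : 0 <= q by rewrite divr_ge0.
have qp : q + p = 1 by rewrite /q /p -mulrDl -natrD addnC divff.
pose T i := q ^+ (N - i) * p ^+ i * 'C(N, i)%:R.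
have T0 i : 0 <= T i by rewrite !mulr_ge0 ?exprn_ge0.
have sumT : \sum_(i < N.+1) T i = 1.
  have := exprDn q p N; rewrite qp expr1n => ->.
  by apply: eq_bigr => i _; rewrite /T mulr_natr.
have sN : (s < N.+1)%N by rewrite /N addSn -addnS ltnS leq_addr.
have s1N : (s.+1 < N.+1)%N by rewrite /N ltnS leq_addr.
have s2N : (s.+2 < N.+1)%N by rewrite /N addnS ltnS -addSn leq_addr.
have le1 : T s + T s.+1 + T s.+2 <= 1.
  rewrite -sumT (bigD1 (Ordinal sN))//= (bigD1 (Ordinal s1N))/=; last first.
    by rewrite -val_eqE /= gtn_eqF.
  rewrite (bigD1 (Ordinal s2N))/=; last by rewrite -!val_eqE /= !gtn_eqF.
  by rewrite !addrA lerDl sumr_ge0.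
have dpsq : d.+1%:R * p = s.+1%:R * q by rewrite /p /q; ring.
have eN : (N - s.+1 = d.+1)%N by rewrite /N addKn.
have eN1 : (N - s = d.+2)%N by rewrite /N addSn -addnS addKn.
have eN2 : (N - s.+2 = d)%N by rewrite /N addnS -addSn addKn.
have b1 : s.+2%:R * 'C(N, s.+2)%:R = d.+1%:R * 'C(N, s.+1)%:R :> R.
  by rewrite -!natrM mul_bin_left eN.
have b2 : d.+2%:R * 'C(N, s)%:R = s.+1%:R * 'C(N, s.+1)%:R :> R.
  by rewrite -!natrM mul_bin_left eN1.
have e1 : s.+2%:R * T s.+2 = s.+1%:R * T s.+1.
  rewrite /T eN eN2 [p ^+ s.+2]exprSr [q ^+ d.+1]exprSr.
  transitivity (q ^+ d * p ^+ s.+1 * p * (s.+2%:R * 'C(N, s.+2)%:R)).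
    by rewrite [LHS]mulrCA [_ * (_ * p)]mulrA.
  rewrite b1; transitivity (q ^+ d * p ^+ s.+1 * 'C(N, s.+1)%:R * (d.+1%:R * p)).
    by move: (q ^+ d) (p ^+ s.+1) ('C(N, s.+1)%:R) (d.+1%:R) => A C D F; ring.
  by rewrite dpsq; move: (q ^+ d) (p ^+ s.+1) ('C(N, s.+1)%:R) (s.+1%:R) => A C D F; ring.
have e2 : d.+2%:R * T s = d.+1%:R * T s.+1.
  rewrite /T eN eN1 [p ^+ s.+1]exprSr [q ^+ d.+2]exprSr.
  transitivity (q ^+ d.+1 * p ^+ s * q * (d.+2%:R * 'C(N, s)%:R)).
    by rewrite [LHS]mulrCA [_ * q * _]mulrAC.
  rewrite b2; transitivity (q ^+ d.+1 * p ^+ s * 'C(N, s.+1)%:R * (s.+1%:R * q)).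
    by move: (q ^+ d.+1) (p ^+ s) ('C(N, s.+1)%:R) (s.+1%:R) => A C D F; ring.
  by rewrite -dpsq; move: (q ^+ d.+1) (p ^+ s) ('C(N, s.+1)%:R) (d.+1%:R) => A C D F; ring.
have h1 : T s.+1 <= 2 * T s.+2.
  rewrite -(@ler_pM2l _ s.+2%:R) ?ltr0n// [_ * (2 * _)]mulrCA e1 [2 * (_ * _)]mulrA ler_wpM2r//.
  by rewrite -natrM ler_nat mul2n -addnn addSn addnS !ltnS leq_addr.
have h2 : T s.+1 <= 2 * T s.
  rewrite -(@ler_pM2l _ d.+2%:R) ?ltr0n// [_ * (2 * _)]mulrCA e2 [2 * (_ * _)]mulrA ler_wpM2r//.
  by rewrite -natrM ler_nat mul2n -addnn addSn addnS !ltnS leq_addr.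
have -> : 'C(N, s.+1)%:R * (p ^+ s.+1 * q ^+ d.+1) = T s.+1.
  by rewrite /T eN [RHS]mulrC [q ^+ _ * _]mulrC.
lra.
Qed.

(** [binomial_mode_le] gives the factor 2 at the frequencies [p0], [q0]. Gibbs' inequality replaces
    these by [p], [q], and raising [s] to [y] only helps because [ln p <= 0]. *)
Lemma binomial_entropy_le (s d : nat) (y : R) : (0 < s)%N -> (0 < d)%N -> s%:R <= y ->
  2 * 'C(s + d, s)%:R <= expR ((y + d%:R) * Ent (y / (y + d%:R))).
Proof.
move=> s0 d0 sy.
have sp : (0 : R) < s%:R by rewrite ltr0n.
have dp : (0 : R) < d%:R by rewrite ltr0n.
have yp : 0 < y by exact: lt_le_trans sp sy.
have ydp : 0 < y + d%:R by rewrite addr_gt0.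
have sdp : (0 : R) < (s + d)%:R by rewrite natrD addr_gt0.
pose p := y / (y + d%:R); pose q := d%:R / (y + d%:R).
pose p0 : R := s%:R / (s + d)%:R; pose q0 : R := d%:R / (s + d)%:R.
have pp : 0 < p by rewrite divr_gt0.
have qp : 0 < q by rewrite divr_gt0.
have p0p : 0 < p0 by rewrite divr_gt0.
have q0p : 0 < q0 by rewrite divr_gt0.
have pq : 1 - p = q by rewrite /p /q; field; rewrite gt_eqF.
have p1 : p <= 1 by rewrite -subr_ge0 pq ltW.
have lnp : ln p <= 0 by rewrite ln_le0.
have -> : (y + d%:R) * Ent (y / (y + d%:R)) = - (y * ln p) - d%:R * ln q.
  have e1 : (y + d%:R) * p = y by rewrite mulrC divfK// gt_eqF.
  have e2 : (y + d%:R) * q = d%:R by rewrite mulrC divfK// gt_eqF.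
  transitivity (- (((y + d%:R) * p) * ln p) - ((y + d%:R) * q) * ln q); last by rewrite e1 e2.
  by rewrite /Ent -/p pq mulrBr mulrA mulrA mulrN mulNr.
have lnle (u v : R) : 0 < u -> 0 < v -> ln u - ln v <= u / v - 1.
  move=> u0 v0; rewrite -ln_div ?posrE//.
  have := @le_ln1Dx R (u / v - 1); rewrite [1 + _]addrC subrK; apply.
  by rewrite ltrBrDr addrC subrr divr_gt0.
have gibbs : s%:R * ln p + d%:R * ln q <= s%:R * ln p0 + d%:R * ln q0.
  have h1 := ler_wpM2l (ltW sp) (lnle p p0 pp p0p).
  have h2 := ler_wpM2l (ltW dp) (lnle q q0 qp q0p).
  have e : s%:R * (p / p0 - 1) + d%:R * (q / q0 - 1) = 0.
    rewrite /p /q /p0 /q0 natrD; field.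
    by rewrite !gt_eqF// addr_gt0.
  lra.
have mode := binomial_mode_le s d s0 d0; rewrite -/p0 -/q0 in mode.
have D0 : 0 < p0 ^+ s * q0 ^+ d by rewrite mulr_gt0 ?exprn_gt0.
apply: (@le_trans _ _ (p0 ^+ s * q0 ^+ d)^-1).
  rewrite -[leRHS]mul1r ler_pdivlMr// -mulrA; lra.
have -> : (p0 ^+ s * q0 ^+ d)^-1 = expR (- (s%:R * ln p0) - d%:R * ln q0).
  by rewrite -opprD expRN expRD !expRM_natl !lnK ?posrE.
rewrite ler_expR.
have h := ler_wnM2r lnp sy.
lra.
Qed.

(** Lets the factor 2 of [binomial_entropy_le] absorb the constant of the rank condition. *)
Lemma sqrt_pi_inv_ge : (2^-1 : R) <= (Num.sqrt pi)^-1.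
Proof.
have pi0 := pi_gt0 R; have pi2 := pihalf_lt2 R.
rewrite lef_pV2 ?posrE ?sqrtr_gt0//.
have -> : (2 : R) = Num.sqrt (2 ^+ 2) by rewrite sqrtr_sqr ger0_norm.
rewrite ler_wsqrtr//; lra.
Qed.

(** * Choice of the temperature and the Taylor degree *)

Section Growth.
(* With g = beta RQ RK, the x and z below are beta RK^2 / tau^2 and
   beta tau^2 RQ^2, and Y is sigma * L. *)
Variables (L g a rho w : R).
Hypotheses (L0 : 0 < L) (g0 : 0 < g) (a2 : 1 / 2 <= a) (rho_gt0 : 0 < rho).
Hypotheses (rho_ge : expR 2 <= rho ^+ 2) (w0 : 0 < w).
Hypothesis wE : w * expR w = (L + 2 * g) / (2 * rho * g).

Let x := g / (rho * expR w).
Let z := g * rho * expR w.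
Let Y := (a * L + g) / w.

(** The Lambert equation turns [z * w] into [L / 2 + g]; here [a >= 1 / 2] enters. *)
Lemma growth_zY : z <= Y.
Proof.
rewrite /Y ler_pdivlMr// /z -[leLHS]mulrA (mulrC _ w) wE.
have -> : g * rho * ((L + 2 * g) / (2 * rho * g)) = L / 2 + g.
  by field; rewrite !gt_eqF.
rewrite lerD2r (mulrC L) ler_wpM2r ?(ltW L0)//.
by move: a2; rewrite div1r.
Qed.

Lemma growth_rho1 : 1 <= rho.
Proof.
have h : 1 ^+ 2 <= rho ^+ 2.
  by rewrite expr1n (le_trans _ rho_ge)// -expR0 ler_expR.
by rewrite ler_sqr ?nnegrE ?(ltW rho_gt0) in h.
Qed.

Lemma growth_log : expR x * expR (- (2 * a * L + Y + 3 * g)) <= expR (- (2 * a * L) - z).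
Proof.
have zY := growth_zY; have rho1 := growth_rho1; have gp := g0.
have xg : x <= g.
  rewrite /x ler_pdivrMr ?mulr_gt0 ?expR_gt0// ler_peMr ?(ltW g0)//.
  by rewrite mulr_ege1// -expR0 ler_expR ltW.
rewrite -expRD ler_expR; lra.
Qed.

(** Replace [N] by [z]: the quotient [x / z] is [expR (- (2 * w)) / rho ^+ 2], and [rho] is at least
    e. *)
Lemma growth_ratio N : Y <= N%:R -> expR 1 * x / N%:R <= expR (- (1 + 2 * w)).
Proof.
move=> YN; have z0 : 0 < z by rewrite !mulr_gt0 ?expR_gt0.
have Y0 := lt_le_trans z0 growth_zY.
have N0 := lt_le_trans Y0 YN.
have x0 : 0 < x by rewrite divr_gt0 ?mulr_gt0 ?expR_gt0.
apply: (@le_trans _ _ (expR 1 * x / z)).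
  have zN := le_trans growth_zY YN.
  apply: ler_wpM2l; first by rewrite mulr_ge0 ?expR_ge0// ltW.
  by rewrite lef_pV2 ?posrE.
have -> : expR 1 * x / z = expR 1 * (rho ^+ 2)^-1 * expR (- (2 * w)).
  rewrite [2 * w]mulrDl mul1r opprD expRD !expRN /x /z; field.
  by rewrite !gt_eqF ?expR_gt0.
rewrite opprD expRD ler_wpM2r ?expR_ge0//.
rewrite ler_pdivrMr ?exprn_gt0//.
apply: le_trans (ler_wpM2l (expR_ge0 _) rho_ge).
by rewrite -expRD ler_expR; lra.
Qed.

(** The power is at most [expR (- ((1 + 2 * w) * Y))], and [(1 + 2 * w) * Y = Y + 2 * (a * L) + 2 *
    g] dominates [2 * a * L + z]. The remaining factor is at most 1/2. *)
Lemma growth_tail N : Y <= N%:R -> x < N%:R /\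
  (expR 1 * x / N%:R) ^+ N * expR (- 1) / (1 - x / N%:R) <= expR (- (2 * a * L) - z) / 2.
Proof.
move=> YN; have r := growth_ratio N YN.
have z0 : 0 < z by rewrite !mulr_gt0 ?expR_gt0.
have Y0 := lt_le_trans z0 growth_zY.
have N0 := lt_le_trans Y0 YN.
have x0 : 0 < x by rewrite divr_gt0 ?mulr_gt0 ?expR_gt0.
have r0 : 0 <= expR 1 * x / N%:R.
  apply: divr_ge0; [apply: mulr_ge0; [exact: expR_ge0|exact: ltW]|exact: ltW].
set E := expR (- 1).
have E0 : 0 < E by exact: expR_gt0.
(* Sharp enough for [E / (1 - E ^+ 2) <= 1 / 2]. *)
have E1 : E <= (4 / 5) ^+ 4.
  have h : (5 / 4 : R) ^+ 4 <= expR 1.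
    have -> : expR 1 = expR (4^-1 : R) ^+ 4 by rewrite -expRM_natr mulVf.
    rewrite lerXn2r ?nnegrE ?expR_ge0//.
    by apply: le_trans (expR_ge1Dx _); lra.
  have -> : (4 / 5 : R) ^+ 4 = ((5 / 4) ^+ 4)^-1 by rewrite -exprVn invf_div.
  by rewrite /E expRN lef_pV2 ?posrE ?expR_gt0 ?exprn_gt0 ?divr_gt0.
have xN : x / N%:R <= E ^+ 2.
  have -> : x / N%:R = E * (expR 1 * x / N%:R).
    by rewrite !mulrA -expRD addNr expR0 mul1r.
  rewrite expr2 ler_wpM2l ?(ltW E0)// (le_trans r)// ler_expR.
  by move: w0; lra.
have EE : E ^+ 2 <= E * (4 / 5) ^+ 4 by rewrite expr2 ler_wpM2l// ltW.
have xN1 : x / N%:R < 1 by lra.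
split; first by rewrite ltr_pdivrMr// mul1r in xN1.
have D0 : 0 < 1 - x / N%:R by lra.
rewrite -mulrA; apply: ler_pM.
- exact: exprn_ge0.
- by apply: divr_ge0; exact: ltW.
- apply: (@le_trans _ _ (expR (- (1 + 2 * w)) ^+ N)).
    by rewrite lerXn2r ?nnegrE ?expR_ge0.
  rewrite -expRM_natr ler_expR.
  have h : (1 + 2 * w) * Y <= (1 + 2 * w) * N%:R.
    by rewrite ler_wpM2l//; move: w0; lra.
  have e : (1 + 2 * w) * Y = Y + 2 * (a * L) + 2 * g.
    by rewrite /Y; field; rewrite gt_eqF.
  have := growth_zY; move: g0; lra.
- rewrite ler_pdivrMr//; lra.
Qed.

End Growth.

(** If [D' <= 0] then [E >= D] and the trivial bound [2 * v] suffices. Otherwise split the error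
    times [D] into three terms; clipping makes the middle one zero or opposite in sign to the
    error. *)
Lemma clip_ratio_error (lo hi v D D' N N' E : R) : 0 < D -> lo <= N / D <= hi ->
  `|lo| <= v -> `|hi| <= v -> `|D' - D| <= E -> `|N' - N| <= v * E ->
  `|N / D - clip (N' / D') lo hi| <= 2 * v * (E / D).
Proof.
move=> D0 /andP[loN Nhi]; rewrite 4!ler_norml.
move=> /andP[lo1 lo2] /andP[hi1 hi2] /andP[D1 D2] /andP[N1 N2].
have v0 : 0 <= v by lra.
set c := clip _ _ _.
have clo : lo <= c by rewrite /c /clip le_min le_max lexx orbT; lra.
have chi : c <= hi by rewrite /c /clip ge_min lexx orbT.
have E0 : 0 <= E by lra.
have [D'0|D'0] := leP D' 0.
  have ED : 1 <= E / D by rewrite ler_pdivlMr// mul1r; lra.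
  apply: (@le_trans _ _ (2 * v)); last by rewrite ler_peMr// mulr_ge0.
  by rewrite ler_norml; lra.
have NE : N = N / D * D by rewrite divfK// gt_eqF.
set O := N / D in loN Nhi NE *.
have key : `|(O - c) * D| <= 2 * v * E.
  have cE : `|(D' - D) * c| <= v * E.
    rewrite normrM mulrC ler_pM// ?ler_norml; lra.
  move: cE; rewrite ler_norml => /andP[c1 c2].
  have -> : (O - c) * D = (N - N') + (N' - c * D') + (D' - D) * c by rewrite NE; ring.
  have N'E : N' / D' * D' = N' by rewrite divfK// gt_eqF.
  (* Either nothing is clipped, or [c] lies between the raw ratio and the exact one. *)
  have tri : [\/ c = N' / D', N' / D' <= c /\ c <= O | c <= N' / D' /\ O <= c].
    rewrite /c /clip; have [h1|h1] := leP (N' / D') lo.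
      by rewrite (min_l (le_trans loN Nhi)); constructor 2.
    have [h2|h2] := leP (N' / D') hi; first by constructor 1.
    by constructor 3; split=> //; exact: ltW.
  case: tri => [xc|[h1 h2]|[h1 h2]].
  - have -> : N' - c * D' = 0 by rewrite xc N'E subrr.
    rewrite ler_norml; lra.
  - have h1' := ler_wpM2r (ltW D'0) h1.
    have h2' : 0 <= (O - c) * D by rewrite mulr_ge0 ?subr_ge0// ltW.
    rewrite ler_norml; move: h2'.
    have -> : (O - c) * D = (N - N') + (N' - c * D') + (D' - D) * c by rewrite NE; ring.
    lra.
  - have h1' := ler_wpM2r (ltW D'0) h1.
    have h2' : (O - c) * D <= 0 by rewrite mulr_le0_ge0 ?subr_le0// ltW.
    rewrite ler_norml; move: h2'.
    have -> : (O - c) * D = (N - N') + (N' - c * D') + (D' - D) * c by rewrite NE; ring.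
    lra.
by rewrite mulrA ler_pdivlMr// -[X in _ * X <= _](gtr0_norm D0) -normrM.
Qed.

End Scalars.

(** * Bins and the approximation error *)

Section Bins.

Lemma sum_bins {V : nmodType} (n B : nat) (F : 'I_n -> V) : (0 < B)%N ->
  \sum_(b <- @bins n B) \sum_(l < n | b l) F l = \sum_l F l.
Proof.
move=> B0; rewrite /bins big_map.
have key B' : \sum_(0 <= b < B') \sum_(l < n | (b * n %/ B <= l < b.+1 * n %/ B)%N) F l
    = \sum_(l < n | (l < B' * n %/ B)%N) F l.
  elim: B' => [|B' IH].
    by rewrite big_geq// mul0n div0n big_pred0.
  rewrite big_nat_recr//= IH [RHS](bigID (fun l : 'I_n => (l < B' * n %/ B)%N))/=.
  have mono : (B' * n %/ B <= B'.+1 * n %/ B)%N by rewrite leq_div2r// leq_mul2r leqnSn orbT.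
  congr (_ + _); apply: eq_bigl => l.
    by apply/idP/andP => [h|[]//]; split=> //; exact: leq_trans h mono.
  by rewrite -leqNgt andbC.
have -> : iota 0 B = index_iota 0 B by rewrite /index_iota subn0.
rewrite key; apply: eq_bigl => l.
by rewrite mulKn// ltn_ord.
Qed.

Context {R : realType} {X : finType} {n : nat}.
Variables (k : X -> X -> R) (pt : 'I_n -> X).
Hypothesis psdk : psd k.

Let kern (i j : 'I_n) := k (pt i) (pt j).

Definition all_admissible (acc : seq (pred 'I_n * seq 'I_n)) :=
  all (fun p => `[< admissible k pt p.2 >]) acc.

(** [bs0] is the full list of bins, so [f] and [g] are compared only at completed runs. *)
Lemma binsExpect_le bs0 r bs acc (f g : seq (pred 'I_n * seq 'I_n) -> R) :
  unzip1 acc ++ bs = bs0 -> all_admissible acc ->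
  (forall acc', unzip1 acc' = bs0 -> all_admissible acc' -> f acc' <= g acc') ->
  binsExpect kern r bs acc f <= binsExpect kern r bs acc g.
Proof.
move=> + + fg; elim: bs acc => [|b bs IH] acc /=; first by rewrite cats0 => h1 h2; exact: fg.
move=> h1 h2; apply: (rpExpect_le _ _ psdk b (admissible k pt)) => //.
- by move=> S l aS _ r0; exact: admissible_rcons.
- exact: admissible_nil.
- move=> S aS; apply: IH; first by rewrite /unzip1 map_rcons cat_rcons.
  by rewrite /all_admissible all_rcons; apply/andP; split=> //; apply/asboolP.
Qed.

Lemma binsExpect_sum r bs acc (G : pred 'I_n -> seq 'I_n -> R) :
  binsExpect kern r bs acc (fun acc => \sum_(p <- acc) G p.1 p.2) =
  \sum_(p <- acc) G p.1 p.2 + \sum_(b <- bs) rpExpect kern b r [::] (G b).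
Proof.
elim: bs acc => [|b bs IH] acc /=; first by rewrite big_nil addr0.
have -> : (fun S => binsExpect kern r bs (rcons acc (b, S)) (fun acc => \sum_(p <- acc) G p.1 p.2))
  = (fun S => 1 * G b S + (\sum_(p <- acc) G p.1 p.2 + \sum_(b <- bs) rpExpect kern b r [::] (G b))).
  by apply/funext => S; rewrite IH -cats1 big_cat big_seq1 /= mul1r addrCA addrA.
by rewrite rpExpect_linear rpExpect_cst mul1r big_cons addrCA.
Qed.

Lemma eq_sum_all {T : Type} (s : seq T) (a : pred T) (F G : T -> R) : all a s ->
  (forall x, a x -> F x = G x) -> \sum_(x <- s) F x = \sum_(x <- s) G x.
Proof.
move=> + FG; elim: s => [|x s IH] /=; first by rewrite !big_nil.
by move=> /andP[ax /IH h]; rewrite !big_cons FG// h.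
Qed.

(** By [residual_nysW] the error is the residual row of [x] paired with [u], and [psd_amgm] bounds
    it entrywise. It serves the denominator with [u = 1] and the numerator with a column of [V]. *)
Lemma nystrom_error B (acc : seq (pred 'I_n * seq 'I_n)) x (u : 'I_n -> R) (v th z : R) :
  (0 < B)%N -> unzip1 acc = @bins n B -> all_admissible acc ->
  0 < th -> k x x <= z -> (forall l, `|u l| <= v) ->
  `| \sum_(p <- acc) \sum_(t < size p.2) k x (pt (tnth (in_tuple p.2) t)) *
        (\sum_(l < n | p.1 l) nysW kern p.2 t l * u l) - \sum_l k x (pt l) * u l |
  <= v * \sum_(p <- acc) ((th * z / 2) * (\sum_(l < n | p.1 l) 1) +
        (2 * th)^-1 * restrace k pt p.1 p.2).
Proof.
move=> B0 accB aacc th0 kz uv.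
rewrite -(sum_bins n B _ B0) -accB big_map.
have -> : \sum_(p <- acc) \sum_(t < size p.2) k x (pt (tnth (in_tuple p.2) t)) *
        (\sum_(l < n | p.1 l) nysW kern p.2 t l * u l) =
   \sum_(p <- acc) \sum_(l < n | p.1 l) (k x (pt l) - residual k pt p.2 x (pt l)) * u l.
  apply: eq_sum_all aacc _ => -[b S] /asboolP /= aS.
  under eq_bigr => t _ do rewrite mulr_sumr.
  rewrite exchange_big /=; apply: eq_bigr => l bl.
  rewrite (residual_nysW _ _ psdk) // opprB addrCA subrr addr0 mulr_suml.
  by apply: eq_bigr => t _; rewrite mulrA.
rewrite -sumrB mulr_sumr; apply: le_trans (ler_norm_sum _ _ _) _.
apply: ler_sum => -[b S] _ /=; rewrite -sumrB.
have -> : th * z / 2 * (\sum_(l < n | b l) 1) + (2 * th)^-1 * restrace k pt b S =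
   \sum_(l < n | b l) ((th * z + residual k pt S (pt l) (pt l) / th) / 2).
  rewrite /restrace !mulr_sumr -big_split/=; apply: eq_bigr => l _.
  by field; rewrite gt_eqF.
rewrite mulr_sumr; apply: le_trans (ler_norm_sum _ _ _) _.
apply: ler_sum => l _.
rewrite -mulrBl addrAC subrr sub0r normrM normrN mulrC.
apply: ler_pM => //.
have pS := psd_residual _ pt psdk S.
apply: le_trans (psd_amgm _ x (pt l) _ th0 pS) _.
rewrite ler_wpM2r// lerD2r ler_wpM2l ?(ltW th0)//.
exact: le_trans (residual_diag_le _ _ psdk S x) kz.
Qed.

End Bins.

(** * Norms and inner products *)

Section Norms.
Context {R : realType}.

Lemma maxnorm_ge0 m n (M : 'M[R]_(m, n)) : 0 <= maxnorm M.
Proof. exact: bigmax_ge_id. Qed.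

Lemma le_maxnorm m n (M : 'M[R]_(m, n)) i j : `|M i j| <= maxnorm M.
Proof.
apply: le_trans (le_bigmax _ _ i).
exact: (le_bigmax _ (fun j => `|M i j|) j).
Qed.

Lemma maxnorm_le m n (M : 'M[R]_(m, n)) (c : R) : 0 <= c ->
  (forall i j, `|M i j| <= c) -> maxnorm M <= c.
Proof.
by move=> c0 Mc; apply: bigmax_le => // i _; apply: bigmax_le => // j _.
Qed.

Lemma dotr_ge0 d (x : 'rV[R]_d) : 0 <= dotr x x.
Proof. by apply: sumr_ge0 => j _; rewrite -expr2 sqr_ge0. Qed.

Lemma dotr_le_norm2 d (x : 'rV[R]_d) (c : R) : norm2 x <= c -> dotr x x <= c ^+ 2.
Proof.
move=> h; rewrite -[leLHS]sqr_sqrtr ?dotr_ge0//.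
by rewrite lerXn2r ?nnegrE ?sqrtr_ge0// (le_trans _ h)// sqrtr_ge0.
Qed.

Lemma dotrZl d (c : R) (x y : 'rV[R]_d) : dotr (c *: x) y = c * dotr x y.
Proof. by rewrite /dotr mulr_sumr; apply: eq_bigr => j _; rewrite mxE mulrA. Qed.

Lemma dotrC d (x y : 'rV[R]_d) : dotr x y = dotr y x.
Proof. by apply: eq_bigr => j _; rewrite mulrC. Qed.

Lemma dotrDr d (x y z : 'rV[R]_d) : dotr x (y + z) = dotr x y + dotr x z.
Proof. by rewrite -big_split; apply: eq_bigr => j _; rewrite mxE mulrDr. Qed.

Lemma dotr_sumr d (I : Type) (r : seq I) (x : 'rV[R]_d) (y : I -> 'rV[R]_d) :
  dotr x (\sum_(i <- r) y i) = \sum_(i <- r) dotr x (y i).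
Proof.
elim/big_rec2: _ => [|i c s _ <-]; last by rewrite dotrDr.
by rewrite /dotr big1// => j _; rewrite mxE mulr0.
Qed.

Lemma sum_centered n d (K : 'M[R]_(n, d)) : (0 < n)%N -> \sum_l (row l K - kbar K) = 0.
Proof.
move=> n0; rewrite sumrB sumr_const card_ord /kbar -scaler_nat scalerA divff ?scale1r ?subrr//.
by rewrite pnatr_eq0 -lt0n.
Qed.

End Norms.

(** * The WildCat output *)

Section Trace.
Context {R : realType} {X : finType} {n d : nat}.
Variables (pts : X -> 'rV[R]_d) (c : R) (pt : 'I_n -> X).
Hypothesis c0 : 0 <= c.
Let k := exp_kernel pts c.
Let kern (i j : 'I_n) := k (pt i) (pt j).

Lemma rpExpect_exp_restrace (bin : pred 'I_n) (r s : nat) (x T : R) :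
  (forall l, c * dotr (pts (pt l)) (pts (pt l)) <= x) -> x < s.+1%:R -> 0 < T ->
  (expR 1 * x / s.+1%:R) ^+ s.+1 * expR (- 1) / (1 - x / s.+1%:R) <= T / 2 ->
  (s = 0%N /\ (0 < r)%N) \/ expR x * expR (- (r%:R / 'C(s + d, s)%:R)) <= T ->
  rpExpect kern bin r [::] (restrace k pt bin) <= 2 * T * \sum_(l < n | bin l) 1.
Proof.
move=> lx xs T0 tailT H.
set nb := \sum_(l < n | bin l) 1.
have nb0 : 0 <= nb by rewrite sumr_ge0.
have psdk := psd_exp_kernel pts c c0.
(* An empty bin is treated apart, since the tail bound must be positive. *)
have [nbz|nbz] := eqVneq nb 0.
  have b0 l : bin l -> False.
    move=> bl; move/eqP: nbz; rewrite psumr_eq0//.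
    by move=> /allP/(_ l (mem_index_enum _)); rewrite bl /= oner_eq0.
  have -> : restrace k pt bin = fun=> 0.
    by apply/funext => S; rewrite /restrace big1// => l /b0.
  by rewrite rpExpect_cst nbz mulr0.
have nbp : 0 < nb by rewrite lt0r nbz.
have [P [hP trP tailP]] := exp_kernel_lowrank pts c c0 n pt bin s.
have C0 : (0 : R) < 'C(s + d, s)%:R by rewrite ltr0n bin_gt0 leq_addr.
have -> : 2 * T * nb = 2 * (nb * T) by ring.
have b0 : 0 < nb * T / 2 by rewrite divr_gt0// mulr_gt0.
apply: (rpExpect_restrace _ pt psdk bin P _ _ hP trP C0 b0 _ r (nb * T) (nb * expR x)) => //.
- apply: le_trans tailP _; rewrite -mulrA /nb mulr_suml; apply: ler_sum => l _.
  rewrite mul1r; apply: le_trans tailT; apply: exp_tail_chernoff => //.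
  by rewrite lx andbT /inner mulr_ge0// dotr_ge0.
- rewrite /nb mulr_suml; apply: ler_sum => l _.
  by rewrite mul1r /residual /= /k /exp_kernel ler_expR /inner lx.
- case: H => [[-> r0]|H]; [left|right]; first by rewrite bin0.
  by rewrite -mulrA ler_wpM2l.
Qed.

End Trace.

Section Output.
Context {R : realType} {m n d : nat}.
Variables (Q : 'M[R]_(m, d)) (K V : 'M[R]_(n, d)) (beta tau : R).
Hypothesis tau0 : tau ^+ 2 != 0.
Hypothesis beta0 : 0 <= beta.
Hypothesis n0 : (0 < n)%N.

(** Queries and keys share one kernel so that positivity links them. The factor [tau ^+ 2] on
    queries undoes the temperature in query-key products. *)
Definition wc_pts (x : 'I_m + 'I_n) : 'rV[R]_d :=
  match x with
  | inl i => tau ^+ 2 *: row i Q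
  | inr l => row l K - kbar K
  end.

Let c := beta / tau ^+ 2.
Let k := exp_kernel wc_pts c.
Let kern (i j : 'I_n) := k (inr i) (inr j).

Lemma wc_kernE : wc_kern beta tau K = kern.
Proof.
apply/funext => i; apply/funext => j.
by rewrite /wc_kern /kern /k /exp_kernel /inner /c /= mulrAC.
Qed.

Lemma exp_kernel_query i l : k (inl i) (inr l) = expR (beta * dotr (row i Q) (row l K - kbar K)).
Proof.
rewrite /k /exp_kernel /inner /= dotrZl /c; congr expR.
by rewrite mulrA divfK.
Qed.

(** Recentring costs a factor free of [l], which cancels in both the exact and the approximate
    ratio. *)
Lemma attnA_kernel i l :
  attnA beta Q K i l = expR (beta * dotr (row i Q) (kbar K)) * k (inl i) (inr l).
Proof.
by rewrite exp_kernel_query -expRD -mulrDr -dotrDr addrC subrK.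
Qed.

(** Bound each exponential by its tangent at 0; the linear terms cancel over centred keys. *)
Lemma kernel_rowsum_ge i : n%:R <= \sum_l k (inl i) (inr l).
Proof.
apply: (@le_trans _ _ (\sum_(l < n) (1 + beta * dotr (row i Q) (row l K - kbar K)))).
  rewrite big_split /= sumr_const card_ord -mulr_sumr -dotr_sumr sum_centered//.
  have -> : dotr (row i Q) 0 = 0 by rewrite /dotr big1// => j _; rewrite [X in _ * X]mxE mulr0.
  by rewrite mulr0 addr0.
by apply: ler_sum => l _; rewrite exp_kernel_query expR_ge1Dx.
Qed.

Lemma exactO_kernel i j : exactO beta Q K V i j =
  (\sum_l k (inl i) (inr l) * V l j) / (\sum_l k (inl i) (inr l)).
Proof.
rewrite mxE; under eq_bigr => l _ do rewrite attnA_kernel -mulrA.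
under [X in _ / X]eq_bigr => l _ do rewrite attnA_kernel.
by rewrite -!mulr_sumr -mulf_div divff ?mul1r// gt_eqF// expR_gt0.
Qed.

Lemma wc_output_kernel acc i j : wc_output beta tau Q K V acc i j =
  clip ((\sum_(p <- acc) \sum_(t < size p.2) k (inl i) (inr (tnth (in_tuple p.2) t)) *
             (\sum_(l < n | p.1 l) nysW kern p.2 t l * V l j)) /
        (\sum_(p <- acc) \sum_(t < size p.2) k (inl i) (inr (tnth (in_tuple p.2) t)) *
             (\sum_(l < n | p.1 l) nysW kern p.2 t l)))
         (\big[Num.min/head 0 [seq V l j | l <- enum 'I_n]]_(l < n) V l j)
         (\big[Num.max/head 0 [seq V l j | l <- enum 'I_n]]_(l < n) V l j).
Proof.
rewrite mxE wc_kernE; congr clip.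
under eq_bigr => p _ do under eq_bigr => t _ do rewrite attnA_kernel -mulrA.
under eq_bigr => p _ do rewrite -mulr_sumr.
under [X in _ / X]eq_bigr => p _ do under eq_bigr => t _ do rewrite attnA_kernel -mulrA.
under [X in _ / X]eq_bigr => p _ do rewrite -mulr_sumr.
by rewrite -!mulr_sumr -mulf_div divff ?mul1r// gt_eqF// expR_gt0.
Qed.

Lemma head_entry_le j : `|head 0 [seq V l j | l <- enum 'I_n]| <= maxnorm V.
Proof.
by case: (enum 'I_n) => [|l s] /=; rewrite ?normr0 ?maxnorm_ge0 ?le_maxnorm.
Qed.

Lemma wc_error B acc (th z : R) : (0 < B)%N -> unzip1 acc = @bins n B ->
  all_admissible k inr acc -> 0 < th ->
  (forall i, beta * tau ^+ 2 * dotr (row i Q) (row i Q) <= z) ->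
  maxnorm (exactO beta Q K V - wc_output beta tau Q K V acc) <=
  \sum_(p <- acc) (2 * maxnorm V / n%:R * (2 * th)^-1 * restrace k inr p.1 p.2 +
    2 * maxnorm V / n%:R * (th * expR z / 2) * (\sum_(l < n | p.1 l) 1)).
Proof.
move=> B0 accB aacc th0 qz.
have psdk := psd_exp_kernel wc_pts c (divr_ge0 beta0 (sqr_ge0 tau)).
pose E := \sum_(p <- acc) ((th * expR z / 2) * (\sum_(l < n | p.1 l) 1) +
        (2 * th)^-1 * restrace k inr p.1 p.2).
have n0' : (0 : R) < n%:R by rewrite ltr0n.
have v0 := maxnorm_ge0 _ _ V.
have E0 : 0 <= E.
  apply: sumr_ge0 => p _; apply: addr_ge0; apply: mulr_ge0.
  - by rewrite divr_ge0// mulr_ge0 ?expR_ge0// ltW.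
  - exact: sumr_ge0.
  - by rewrite invr_ge0 mulr_ge0// ltW.
  - exact: restrace_ge0 psdk _ _.
have -> : \sum_(p <- acc) (2 * maxnorm V / n%:R * (2 * th)^-1 * restrace k inr p.1 p.2 +
    2 * maxnorm V / n%:R * (th * expR z / 2) * (\sum_(l < n | p.1 l) 1)) =
    2 * maxnorm V * (E / n%:R).
  rewrite /E mulr_suml mulr_sumr; apply: eq_bigr => p _.
  move: (2 * th)^-1 (n%:R^-1) (restrace k inr p.1 p.2) (\sum_(l < n | p.1 l) 1) => A C F G.
  ring.
apply: maxnorm_le => [|i j]; first by rewrite !mulr_ge0// invr_ge0 ltW.
rewrite [X in `|X|]mxE [X in _ + X]mxE exactO_kernel wc_output_kernel.
have kz : k (inl i) (inl i) <= expR z.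
  rewrite /k /exp_kernel /inner ler_expR (le_trans _ (qz i))//= dotrZl dotrC dotrZl /c.
  by rewrite mulrA divfK// mulrA.
set D := \sum_l k (inl i) (inr l).
have nD : n%:R <= D := kernel_rowsum_ge i.
have D0 : 0 < D := lt_le_trans n0' nD.
have k0 l : 0 <= k (inl i) (inr l) by exact: expR_ge0.
pose l0 : 'I_n := Ordinal n0.
apply: (@le_trans _ _ (2 * maxnorm V * (E / D))); last first.
  apply: ler_wpM2l; first by rewrite mulr_ge0.
  apply: ler_wpM2l => //.
  by rewrite lef_pV2 ?posrE.
have hle := head_entry_le j; have Vle l := le_maxnorm _ _ V l j.
have lo_le l : \big[Num.min/head 0 [seq V l j | l <- enum 'I_n]]_(l < n) V l j <= V l j.
  exact: (bigmin_le _ _ (fun l => V l j)).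
have le_hi l : V l j <= \big[Num.max/head 0 [seq V l j | l <- enum 'I_n]]_(l < n) V l j.
  exact: (le_bigmax _ (fun l => V l j)).
apply: clip_ratio_error => //.
- rewrite ler_pdivlMr// ler_pdivrMr// /D !mulr_sumr; apply/andP; split; apply: ler_sum => l _.
    by rewrite mulrC ler_wpM2l.
  by rewrite [leRHS]mulrC ler_wpM2l.
- rewrite ler_norml; apply/andP; split.
    apply: le_bigmin; first by move: hle; rewrite ler_norml => /andP[].
    by move=> l _; move: (Vle l); rewrite ler_norml => /andP[].
  by apply: le_trans (lo_le l0) _; move: (Vle l0); rewrite ler_norml => /andP[].
- rewrite ler_norml; apply/andP; split.
    by apply: le_trans (le_hi l0); move: (Vle l0); rewrite ler_norml => /andP[].
  apply: bigmax_le; first by move: hle; rewrite ler_norml => /andP[].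
  by move=> l _; move: (Vle l); rewrite ler_norml => /andP[].
- have := nystrom_error _ inr psdk B acc (inl i) (fun=> 1) 1 th (expR z) B0 accB aacc th0 kz.
  rewrite mul1r -/E; under [\sum_l _ * 1]eq_bigr => l _ do rewrite mulr1.
  under [X in `|X - _|]eq_bigr => p _ do under eq_bigr => t _ do
    under eq_bigr => l _ do rewrite mulr1.
  by apply => l; rewrite normr1.
- exact: nystrom_error _ inr psdk B acc (inl i) (fun l => V l j) _ th (expR z) B0 accB aacc th0 kz Vle.
Qed.

End Output.

Theorem theorem2 (R : realType) (m n d : nat)
    (Q : 'M[R]_(m, d)) (K V : 'M[R]_(n, d)) (beta a : R) (B r : nat) :
  0 < beta -> 1 / 2 <= a -> (0 < B)%N ->
  (2 <= n %/ B)%N -> 0 < RQ Q -> 0 < RK K ->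
  let neff : nat := (n %/ B)%N in
  let reff : nat := ((r + B.-1) %/ B)%N in   (* = ceil (r / B) *)
  let Ln : R := ln (neff%:R) in
  let gamma : R := beta * RQ Q * RK K / Ln in
  let delta : R := d%:R / Ln in
  let sigma : R := (a + gamma) / lambertW0 (1 / (2 * rho0 * gamma) + 1 / rho0) in
  1 + (Num.sqrt pi)^-1
        * (neff%:R `^ ((sigma + delta) * Ent (sigma / (sigma + delta))))
        * ln (neff%:R `^ (2 * a + sigma + 3 * gamma)) <= reff%:R ->
  let tau : R := wc_tau beta Q K neff in
  binsExpect (wc_kern beta tau K) reff (@bins n B) [::]
    (fun acc => maxnorm (exactO beta Q K V - wc_output beta tau Q K V acc))
  <= 3 * maxnorm V * neff%:R `^ (- a).
Proof.
move=> beta0 a2 B0 nB RQ0 RK0 neff reff Ln gamma delta sigma rank.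
set tau := wc_tau beta Q K neff; cbv zeta.
have neff1 : (1 : R) < neff%:R by rewrite ltr1n.
have neff0 : (0 : R) < neff%:R by exact: lt_trans ltr01 neff1.
have L0 : 0 < Ln by rewrite ln_gt0.
have n0 : (0 < n)%N.
  by case: (n) nB => //; rewrite div0n.
have nR : (0 : R) < n%:R by rewrite ltr0n.
have d0 : (0 < d)%N.
  rewrite lt0n; apply/eqP => d0; move: RQ0; apply/negP; rewrite -leNgt.
  apply: bigmax_le => // i _; rewrite /norm2 /dotr big1 ?sqrtr0// => j.
  by exfalso; have := ltn_ord j; rewrite {2}d0.
have [rho0p rho_ge] := @rho0P R.
set rho : R := rho0 in rho0p rho_ge *.
pose g := beta * RQ Q * RK K.
have g0 : 0 < g by rewrite !mulr_gt0.
have gammaL : gamma * Ln = g by rewrite divfK// gt_eqF.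
have deltaL : delta * Ln = d%:R by rewrite divfK// gt_eqF.
pose arg := (Ln + 2 * g) / (2 * rho * g).
have arg0 : 0 < arg by rewrite divr_gt0 ?addr_gt0 ?mulr_gt0.
have argE : 1 / (2 * rho * gamma) + 1 / rho = arg.
  by rewrite /gamma -/g /arg; field; rewrite !gt_eqF.
pose w := lambertW0 arg.
have [w0 wE] := lambertW0P _ arg0; rewrite -/w in w0 wE.
pose Y := (a * Ln + g) / w.
have sigmaL : sigma * Ln = Y.
  by rewrite /sigma -/rho argE -/w /Y -gammaL; field; rewrite gt_eqF.
(* The Lambert equation removes the quotient by [w] from the definition of [tau]. *)
have tau2 : tau ^+ 2 = RK K / RQ Q * (rho * expR w).
  rewrite /tau /wc_tau -/Ln -/rho -/g.
  have -> : (Ln / g + 2) / (2 * rho) = arg.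
    by rewrite /arg; field; rewrite !gt_eqF.
  have -> : Ln / g + 2 = 2 * (rho * expR w) * w.
    have -> : 2 * (rho * expR w) * w = 2 * rho * (w * expR w) by ring.
    by rewrite wE /arg; field; rewrite !gt_eqF.
  rewrite -/w.
  have -> : 2 * (rho * expR w) * w / (2 * w) = rho * expR w.
    by field; rewrite gt_eqF.
  rewrite sqr_sqrtr//; apply: ltW; apply: mulr_gt0; first exact: divr_gt0.
  by rewrite mulr_gt0 ?expR_gt0.
have tau2p : 0 < tau ^+ 2.
  by rewrite tau2; apply: mulr_gt0; [exact: divr_gt0|rewrite mulr_gt0 ?expR_gt0].
have tau2n : tau ^+ 2 != 0 by rewrite gt_eqF.
pose x := g / (rho * expR w); pose z := g * rho * expR w.
have ew0 := expR_gt0 w.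
have xE : beta / tau ^+ 2 * RK K ^+ 2 = x.
  by rewrite tau2 /x /g; field; rewrite !gt_eqF.
have zE : beta * tau ^+ 2 * RQ Q ^+ 2 = z.
  by rewrite tau2 /z /g; field; rewrite !gt_eqF.
have a0 : 0 < a by apply: lt_le_trans a2; rewrite divr_gt0.
have Y0 : 0 < Y by rewrite divr_gt0// addr_gt0// mulr_gt0.
(* [s <= Y] serves the entropy bound, and [s.+1], where the Taylor tail starts, is above [Y] as
   [growth_tail] requires. *)
pose s := Num.trunc Y.
have /andP[sY Ys] : s%:R <= Y < s.+1%:R by apply: truncn_itv; exact: ltW.
pose T := expR (- (2 * a * Ln) - z).
have T0 : 0 < T by exact: expR_gt0.
have [xs tailT] := growth_tail Ln g a rho w L0 g0 a2 rho0p rho_ge w0 wE _ (ltW Ys).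
have logT := growth_log Ln g a rho w L0 g0 a2 rho0p rho_ge w0 wE.
pose Lam := 2 * a * Ln + Y + 3 * g.
have lnE : ln (neff%:R `^ (2 * a + sigma + 3 * gamma)) = Lam.
  by rewrite ln_powR -/Ln /Lam -sigmaL -gammaL; ring.
have Lam0 : 0 < Lam.
  apply: addr_gt0; last exact: mulr_gt0.
  by apply: addr_gt0 => //; rewrite !mulr_gt0.
have powE e : neff%:R `^ e = expR (e * Ln) by rewrite /powR gt_eqF.
pose Ent_ := expR ((Y + d%:R) * Ent (Y / (Y + d%:R))).
have EntE : neff%:R `^ ((sigma + delta) * Ent (sigma / (sigma + delta))) = Ent_.
  rewrite powE /Ent_ -sigmaL -deltaL -mulrDl -mulf_div divff ?gt_eqF// mulr1.
  by rewrite mulrAC.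
rewrite lnE EntE in rank.
have pi4 := @sqrt_pi_inv_ge R.
have Ent0 : 0 < Ent_ by exact: expR_gt0.
have sp0 : 0 < (Num.sqrt pi)^-1 :> R by rewrite invr_gt0 sqrtr_gt0 pi_gt0.
have reff1 : (1 : R) < reff%:R.
  by apply: lt_le_trans rank; rewrite ltrDl !mulr_gt0.
have cases : (s = 0%N /\ (0 < reff)%N) \/
    expR x * expR (- (reff%:R / 'C(s + d, s)%:R)) <= T.
  have [s0|s0] := posnP s; first by left; split=> //; rewrite -(ltr0n R) (lt_trans ltr01).
  right; apply: le_trans logT; rewrite -/x ler_wpM2l ?expR_ge0// ler_expR lerN2.
  have C0 : (0 : R) < 'C(s + d, s)%:R by rewrite ltr0n bin_gt0 leq_addr.
  rewrite -/Lam ler_pdivlMr// mulrC.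
  apply: (@le_trans _ _ (2^-1 * Ent_ * Lam)).
    rewrite ler_pM2r// mulrC ler_pdivlMr// mulrC.
    exact: binomial_entropy_le.
  apply: (@le_trans _ _ ((Num.sqrt pi)^-1 * Ent_ * Lam)); last first.
    by apply: le_trans rank; rewrite lerDr.
  by rewrite ler_pM2r// ler_pM2r.
(* 3/2 is a rational stand-in for the optimal square root of 2: the trace and query terms become 4/3
   and 3/2, whose sum 17/6 is below 3. *)
pose th := 3 / 2 * expR (- (a * Ln) - z).
have th0 : 0 < th by rewrite mulr_gt0 ?expR_gt0.
pose pts := wc_pts Q K tau; pose c := beta / tau ^+ 2.
have c0 : 0 <= c by rewrite divr_ge0 ?ltW.
pose k := exp_kernel pts c.
have psdk : psd k := psd_exp_kernel pts c c0.
have v0 := maxnorm_ge0 _ _ V.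
pose C1 := 2 * maxnorm V / n%:R * (2 * th)^-1.
pose C2 := 2 * maxnorm V / n%:R * (th * expR z / 2).
have C10 : 0 <= C1.
  apply: mulr_ge0; first by rewrite divr_ge0// mulr_ge0.
  by rewrite invr_ge0 mulr_ge0// ltW.
rewrite (wc_kernE Q K beta tau).
pose G (b : pred 'I_n) S := C1 * restrace k inr b S + C2 * (\sum_(l < n | b l) 1).
apply: (@le_trans _ _ (binsExpect (fun i j => k (inr i) (inr j)) reff (@bins n B) [::]
    (fun acc => \sum_(p <- acc) G p.1 p.2))).
  apply: (binsExpect_le k inr psdk (@bins n B)) => // acc accB aacc.
  apply: (wc_error Q K V beta tau tau2n (ltW beta0) n0 B acc th z) => // i.
  rewrite -zE; apply: ler_wpM2l; first by apply: mulr_ge0; exact: ltW.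
  apply: dotr_le_norm2.
  exact: (le_bigmax _ (fun i => norm2 (row i Q))).
rewrite (binsExpect_sum k inr) big_nil add0r.
apply: (@le_trans _ _ (\sum_(b <- @bins n B) (C1 * (2 * T) + C2) * (\sum_(l < n | b l) 1))).
  apply: ler_sum => b _.
  rewrite rpExpect_linear rpExpect_cst mulrDl lerD2r -mulrA ler_wpM2l//.
  apply: (rpExpect_exp_restrace pts c inr c0 b reff s x T) => // l.
  rewrite -xE ler_wpM2l//; apply: dotr_le_norm2.
  exact: (le_bigmax _ (fun l => norm2 (row l K - kbar K))).
(* Each bound is proportional to the bin size, so bins of unequal size still total [n], which
   cancels the [n] in [C1] and [C2]. *)
rewrite -mulr_sumr (sum_bins n B (fun=> 1) B0) sumr_const card_ord.
rewrite powE mulNr.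
have TE : T = expR (- (a * Ln)) * expR (- (a * Ln) - z).
  by rewrite /T -expRD; congr expR; ring.
have zE' : expR (- (a * Ln) - z) * expR z = expR (- (a * Ln)).
  by rewrite -expRD subrK.
have u0 : 0 < expR (- (a * Ln) - z) by exact: expR_gt0.
have -> : (C1 * (2 * T) + C2) * n%:R = maxnorm V * (17 / 6 * expR (- (a * Ln))).
  rewrite /C1 /C2 /th TE -(mulrA (3 / 2)) zE'; field.
  by rewrite !gt_eqF.
rewrite (mulrC 3) -[leRHS]mulrA; apply: ler_wpM2l => //.
by rewrite ler_wpM2r ?expR_ge0// ler_pdivrMr// -natrM ler_nat.
Qed.
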